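(* Let $(M,g)$ be a Riemannian manifold of dimension $n\ge2$, and let $V=V_0\oplus V_1\oplus V_2$, the linear connection $\tilde\nabla$ on $V$ and the operator $L:C^\infty(M,\mathbb R)\to\Gamma(V)$ be as in the context. Let $D:C^\infty(M,\mathbb R)\to\Gamma(S^2_0T^*M)$ be a quasi-linear differential operator of second order whose principal symbol is the projection $S^2T^*M\to S^2_0T^*M$ onto the tracefree part. Then there is a (not necessarily linear) bundle map $C:V\to T^*M\otimes V$ which has the property that $f\mapsto L(f)$ and $\Sigma\mapsto\Sigma_0$ induce inverse bijections between the set of solutions $f\in C^\infty(M,\mathbb R)$ of $D(f)=0$ and the set of solutions $\Sigma\in\Gamma(V)$ of $\tilde\nabla\Sigma+C(\Sigma)=0$. If $D$ is linear, then $C$ can be chosen to be a vector bundle map.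
   Context: $V=V_0\oplus V_1\oplus V_2$ where $V_0=V_2=M\times\mathbb R$ and $V_1=T^*M$. Sections are written as columns $\Sigma=\begin{pmatrix}h\\ \varphi_b\\ f\end{pmatrix}$ with $f=\Sigma_0\in\Gamma(V_0)=C^\infty(M,\mathbb R)$ (bottom), $\varphi_b\in\Gamma(V_1)=\Omega^1(M)$ and $h\in\Gamma(V_2)=C^\infty(M,\mathbb R)$ (top). With $\nabla$ the Levi-Civita connection (applied componentwise), the linear connection $\tilde\nabla=\nabla+\partial$ on $V$ is $$\tilde\nabla_a\begin{pmatrix}h\\ \varphi_b\\ f\end{pmatrix}=\begin{pmatrix}\nabla_ah\\ \nabla_a\varphi_b+hg_{ab}\\ \nabla_af-\varphi_a\end{pmatrix}.$$ The operator $L$ is $L(f)=\begin{pmatrix}-\tfrac1n\Delta f\\ \nabla_af\\ f\end{pmatrix}$, $\Delta=\nabla^b\nabla_b$. $S^2_0T^*M$ is the bundle of tracefree symmetric two-tensors. Everything is smooth; ''bundle map'' means a smooth fiber-preserving map over $\mathrm{id}_M$, not necessarily fiberwise linear, while ''vector bundle map'' is fiberwise linear. That $D$ is quasi-linear of second order with the stated principal symbol means that $D(f)=\nabla_{(a}\nabla_{b)_0}f+D_1(f)$, where $\nabla_{(a}\nabla_{b)_0}f=\nabla_a\nabla_bf-\tfrac1ng_{ab}\Delta f$ and $D_1:C^\infty(M,\mathbb R)\to\Gamma(S^2_0T^*M)$ is a possibly non-linear differential operator of order at most one. *)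

(* Defs.v *)
From HB Require Import structures.
From mathcomp Require Import all_boot all_order all_algebra.
From mathcomp Require Import all_classical all_reals all_analysis.
Import Order.TTheory GRing.Theory Num.Theory.
Import numFieldNormedType.Exports.

Set Implicit Arguments.
Unset Strict Implicit.
Unset Printing Implicit Defensive.

Local Open Scope classical_set_scope.
Local Open Scope ring_scope.

(* Only used on open sets of finite-dimensional spaces, where it is the usual
   notion: all iterated directional derivatives of order at most k exist and
   are continuous. *)
Fixpoint Ck (R : realType) (V W : normedModType R) (k : nat)
    (U : set V) (f : V -> W) : Prop :=
  (forall x, U x -> {for x, continuous f}) /\
  match k with
  | 0 => True
  | k'.+1 => forall v : V,
      (forall x, U x -> derivable f x v) /\ Ck k' U (fun x => 'D_v f x)
  end.

Definition smooth_on (R : realType) (V W : normedModType R)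
    (U : set V) (f : V -> W) : Prop := forall k, Ck k U f.

(* A smooth n-manifold given by an atlas.  [coord i] and [param i] are
   meaningful only on [dom i] and on its image [cdom i].  [chart_at p] is a
   preferred chart around p; it is used to identify the fibres of tensor bundles
   at p with spaces of matrices. *)
Record manifold (R : realType) (n : nat) := Manifold {
  space :> topologicalType;
  atlas : Type;
  dom : atlas -> set space;
  coord : atlas -> space -> 'rV[R]_n;
  param : atlas -> 'rV[R]_n -> space;
  chart_at : space -> atlas;
  _ : hausdorff_space space;
  _ : @second_countable space;
  _ : forall i, open (dom i);
  _ : forall i, open (coord i @` dom i);
  _ : forall i p, dom i p -> param i (coord i p) = p;
  _ : forall i p, dom i p -> {for p, continuous (coord i)};
  _ : forall i p, dom i p -> {for coord i p, continuous (param i)};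
  _ : forall i j, smooth_on (coord j @` (dom i `&` dom j))
                            (coord i \o param j);
  _ : forall p, dom (chart_at p) p
}.

Definition cdom (R : realType) (n : nat) (M : manifold R n) (i : atlas M) :
  set 'rV[R]_n := coord i @` dom i.

Definition partial (R : realType) (n : nat) (M : manifold R n)
    (i : atlas M) (a : 'I_n) (f : M -> R) (p : M) : R :=
  'D_(delta_mx 0 a) (f \o param i : 'rV[R]_n -> R^o) (coord i p).

(* The (b, a) entry is the derivative of the a-th coordinate of the chart i along
   the b-th coordinate of the chart j.  The components of a covector, written as
   a column, transform by w_j = jac i j p *m w_i. *)
Definition jac (R : realType) (n : nat) (M : manifold R n)
    (i j : atlas M) (p : M) : 'M[R]_n :=
  \matrix_(b, a) partial j b (fun q => coord i q 0 a) p.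

(* Vector bundles are given by a model fibre F and the change of components
   [tr i j p : F -> F] from the chart i to the chart j at p.  The fibre over p is
   F itself, through the components in the chart [chart_at p]: a section is a
   function M -> F and a fibre-preserving map is a function M -> F -> F'. *)
Definition transition (R : realType) (n : nat) (M : manifold R n) (F : Type) :=
  atlas M -> atlas M -> M -> F -> F.

Definition components (R : realType) (n : nat) (M : manifold R n) (F : Type)
    (tr : transition M F) (i : atlas M) (s : M -> F) (p : M) : F :=
  tr (chart_at p) i p (s p).

Definition smooth_section (R : realType) (n : nat) (M : manifold R n)
    (F : normedModType R) (tr : transition M F) (s : M -> F) : Prop :=
  forall i, smooth_on (cdom i) (components tr i s \o param i).

Definition bundle_map_in_chart (R : realType) (n : nat) (M : manifold R n)
    (F F' : Type) (tr : transition M F) (tr' : transition M F')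
    (C : M -> F -> F') (i : atlas M) (x : 'rV[R]_n * F) : F' :=
  let p := param i x.1 in
  tr' (chart_at p) i p (C p (tr i (chart_at p) p x.2)).

Definition bundle_map (R : realType) (n : nat) (M : manifold R n)
    (F F' : normedModType R) (tr : transition M F) (tr' : transition M F')
    (C : M -> F -> F') : Prop :=
  forall i, smooth_on [set x : 'rV[R]_n * F | cdom i x.1]
                      (bundle_map_in_chart tr tr' C i).

Definition vector_bundle_map (R : realType) (n : nat) (M : manifold R n)
    (F F' : normedModType R) (tr : transition M F) (tr' : transition M F')
    (C : M -> F -> F') : Prop :=
  bundle_map tr tr' C /\ forall p, linear (C p).

(* M x R *)
Definition transition_R (R : realType) (n : nat) (M : manifold R n) :
  transition M R^o := fun _ _ _ v => v.
Arguments transition_R {R n} M.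

(* T*M *)
Definition transition_T1 (R : realType) (n : nat) (M : manifold R n) :
  transition M 'cV[R]_n := fun i j p w => jac i j p *m w.
Arguments transition_T1 {R n} M.

(* T*M (x) T*M *)
Definition transition_T2 (R : realType) (n : nat) (M : manifold R n) :
  transition M 'M[R]_n := fun i j p T => jac i j p *m T *m (jac i j p)^T.
Arguments transition_T2 {R n} M.

(* V = V_2 (+) V_1 (+) V_0, elements being ((h, phi), f). *)
Definition fiber_V (R : realType) (n : nat) : normedModType R :=
  (R^o * 'cV[R]_n * R^o)%type.

Definition transition_V (R : realType) (n : nat) (M : manifold R n) :
  transition M (fiber_V R n) :=
  fun i j p s => (s.1.1, transition_T1 M i j p s.1.2, s.2).
Arguments transition_V {R n} M.

(* T*M (x) V = T*M (+) (T*M (x) T*M) (+) T*M, the row index of the middle slot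
   being the one of the T*M factor. *)
Definition fiber_TV (R : realType) (n : nat) : normedModType R :=
  ('cV[R]_n * 'M[R]_n * 'cV[R]_n)%type.

Definition transition_TV (R : realType) (n : nat) (M : manifold R n) :
  transition M (fiber_TV R n) :=
  fun i j p t => (transition_T1 M i j p t.1.1, transition_T2 M i j p t.1.2,
                  transition_T1 M i j p t.2).
Arguments transition_TV {R n} M.

(* The bundle J^1(M, R) = (M x R) (+) T*M of 1-jets of functions, the 1-jet of f
   at p being (f p, df p). *)
Definition fiber_J1 (R : realType) (n : nat) : normedModType R :=
  (R^o * 'cV[R]_n)%type.

Definition transition_J1 (R : realType) (n : nat) (M : manifold R n) :
  transition M (fiber_J1 R n) :=
  fun i j p u => (u.1, transition_T1 M i j p u.2).
Arguments transition_J1 {R n} M.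

Definition smooth_function (R : realType) (n : nat) (M : manifold R n)
  (f : M -> R^o) : Prop := smooth_section (transition_R M) f.

Definition riemannian_metric (R : realType) (n : nat) (M : manifold R n)
    (g : M -> 'M[R]_n) : Prop :=
  [/\ smooth_section (transition_T2 M) g,
      forall p, (g p)^T = g p
    & forall p (v : 'rV[R]_n), v != 0 -> 0 < (v *m g p *m v^T) 0 0].

(* A linear connection on TM, given by its coefficients in the charts:
   in the chart i, nabla_a d_b = \sum_c Gamma i p c a b d_c. *)
Definition coefficients (R : realType) (n : nat) (M : manifold R n) :=
  atlas M -> M -> 'I_n -> 'I_n -> 'I_n -> R.

Definition linear_connection (R : realType) (n : nat) (M : manifold R n)
    (Gamma : coefficients M) : Prop :=
  (forall i c a b, smooth_on (cdom i)
     ((fun p => Gamma i p c a b) \o param i : 'rV[R]_n -> R^o)) /\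
  (forall i j p, dom i p -> dom j p -> forall k a b,
     \sum_c Gamma j p c a b * jac i j p c k =
     \sum_l \sum_m Gamma i p k l m * jac i j p a l * jac i j p b m +
     partial j a (partial j b (fun q => coord i q 0 k)) p).

Definition torsion_free (R : realType) (n : nat) (M : manifold R n)
    (Gamma : coefficients M) : Prop :=
  forall i p, dom i p -> forall c a b, Gamma i p c a b = Gamma i p c b a.

Definition metric_compatible (R : realType) (n : nat) (M : manifold R n)
    (g : M -> 'M[R]_n) (Gamma : coefficients M) : Prop :=
  forall i p, dom i p -> forall a b c,
    let gi := components (transition_T2 M) i g in
    partial i a (fun q => gi q b c) p =
    \sum_d (Gamma i p d a b * gi p d c + Gamma i p d a c * gi p b d).

Definition levi_civita (R : realType) (n : nat) (M : manifold R n)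
    (g : M -> 'M[R]_n) (Gamma : coefficients M) : Prop :=
  [/\ linear_connection Gamma, torsion_free Gamma & metric_compatible g Gamma].

Definition exterior_d (R : realType) (n : nat) (M : manifold R n)
    (f : M -> R) (p : M) : 'cV[R]_n :=
  \col_a partial (chart_at p) a f p.

(* (nabla_a phi_b)_(a, b), computed at p in the chart [chart_at p]. *)
Definition cov_deriv (R : realType) (n : nat) (M : manifold R n)
    (Gamma : coefficients M) (phi : M -> 'cV[R]_n) (p : M) : 'M[R]_n :=
  let i := chart_at p in
  let phi_i := components (transition_T1 M) i phi in
  \matrix_(a, b) (partial i a (fun q => phi_i q b 0) p -
                  \sum_c Gamma i p c a b * phi_i p c 0).

Definition hessian (R : realType) (n : nat) (M : manifold R n)
    (Gamma : coefficients M) (f : M -> R) (p : M) : 'M[R]_n :=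
  cov_deriv Gamma (exterior_d f) p.

Definition trace_g (R : realType) (n : nat) (M : manifold R n)
    (g : M -> 'M[R]_n) (p : M) (T : 'M[R]_n) : R := \tr (invmx (g p) *m T).

Definition laplacian (R : realType) (n : nat) (M : manifold R n)
    (g : M -> 'M[R]_n) (Gamma : coefficients M) (f : M -> R) (p : M) : R :=
  trace_g g p (hessian Gamma f p).

Definition hessian0 (R : realType) (n : nat) (M : manifold R n)
    (g : M -> 'M[R]_n) (Gamma : coefficients M) (f : M -> R) (p : M) :
    'M[R]_n :=
  hessian Gamma f p - (n%:R^-1 * laplacian g Gamma f p) *: g p.

(* The fibre of S^2_0 T*M over p, inside that of T*M (x) T*M. *)
Definition S20 (R : realType) (n : nat) (M : manifold R n)
    (g : M -> 'M[R]_n) (p : M) : set 'M[R]_n :=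
  [set T | T^T = T /\ trace_g g p T = 0].

Definition S20_section (R : realType) (n : nat) (M : manifold R n)
    (g : M -> 'M[R]_n) (T : M -> 'M[R]_n) : Prop :=
  smooth_section (transition_T2 M) T /\ forall p, S20 g p (T p).

(* A (possibly non-linear) differential operator C^oo(M, R) -> Gamma(S^2_0 T*M)
   of order at most one: it is induced by a bundle map J^1(M, R) -> S^2_0 T*M. *)
Definition first_order_operator (R : realType) (n : nat) (M : manifold R n)
    (g : M -> 'M[R]_n) (D1 : (M -> R^o) -> M -> 'M[R]_n) : Prop :=
  exists A : M -> fiber_J1 R n -> 'M[R]_n,
    [/\ bundle_map (transition_J1 M) (transition_T2 M) A,
        forall p u, S20 g p (A p u)
      & forall f, smooth_function f ->
          forall p, D1 f p = A p (f p, exterior_d f p)].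

Definition quasilinear_tracefree_hessian_symbol
    (R : realType) (n : nat) (M : manifold R n) (g : M -> 'M[R]_n)
    (Gamma : coefficients M) (D : (M -> R^o) -> M -> 'M[R]_n) : Prop :=
  exists2 D1, first_order_operator g D1
    & forall f, smooth_function f ->
        forall p, D f p = hessian0 g Gamma f p + D1 f p.

Definition linear_operator (R : realType) (n : nat) (M : manifold R n)
    (D : (M -> R^o) -> M -> 'M[R]_n) : Prop :=
  forall (a : R) f u, smooth_function f -> smooth_function u ->
    forall p, D (fun q => a * f q + u q) p = a *: D f p + D u p.

Definition nabla_tilde (R : realType) (n : nat) (M : manifold R n)
    (g : M -> 'M[R]_n) (Gamma : coefficients M) (S : M -> fiber_V R n) (p : M) :
    fiber_TV R n :=
  (exterior_d (fun q => (S q).1.1) p,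
   cov_deriv Gamma (fun q => (S q).1.2) p + (S p).1.1 *: g p,
   exterior_d (fun q => (S q).2) p - (S p).1.2).

Definition splitting_L (R : realType) (n : nat) (M : manifold R n)
    (g : M -> 'M[R]_n) (Gamma : coefficients M) (f : M -> R^o) (p : M) :
    fiber_V R n :=
  (- (n%:R^-1 * laplacian g Gamma f p), exterior_d f p, f p).

Definition slot0 (R : realType) (n : nat) (M : manifold R n)
  (S : M -> fiber_V R n) (p : M) : R^o := (S p).2.

Definition solutions_D (R : realType) (n : nat) (M : manifold R n)
    (D : (M -> R^o) -> M -> 'M[R]_n) : set (M -> R^o) :=
  [set f | smooth_function f /\ forall p, D f p = 0].

Definition solutions_V (R : realType) (n : nat) (M : manifold R n)
    (g : M -> 'M[R]_n) (Gamma : coefficients M)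
    (C : M -> fiber_V R n -> fiber_TV R n) : set (M -> fiber_V R n) :=
  [set S | smooth_section (transition_V M) S /\
           forall p, nabla_tilde g Gamma S p + C p (S p) = 0].

Definition inverse_bijections (T U : Type) (A : set T) (B : set U)
    (F : T -> U) (G : U -> T) : Prop :=
  [/\ set_fun A B F, set_fun B A G, {in A, cancel F G} & {in B, cancel G F}].

(* Main.v *)
(* Write a solution of D(f) = 0 as Hess f + h g + A(f, df) = 0 with
   h = -(Delta f)/n.  In a chart the second partial derivatives of f are then
   functions P_bc(x, h, f, df) of the point z = (x, h, f, df).  Differentiating
   once more and using the symmetry of third partial derivatives gives
     -d_a h g_bc + Q_abc(z) = -d_b h g_ac + Q_bac(z),
   where Q_abc is the derivative of P_bc along (e_a, 0, f_a, P_a.).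
   Contracting with g^bc yields (n - 1) d_a h = g^bc (Q_abc - Q_bac), so
   dh = tau(z) and C(h, phi, f) = (-tau, A(f, phi), 0) works; conversely the two
   lower slots of a parallel section give phi = df and h = -(Delta f)/n, hence
   D(f) = 0.
   Chart independence of tau needs neither curvature nor covariant derivatives:
   for any functions u and H, E = Hess u + H g + A(u, du) is a tensor; taking H
   constant and u quadratic in one chart with the prescribed 2-jet, E vanishes at
   the point, so d_a E_bc - d_b E_ac = Q_bac - Q_abc transforms as a tensor there.
   If D is linear, A is replaced by the derivative of A at the zero jet, which
   agrees with A on all jets of global functions and makes tau fiberwise linear. *)

Require Import Defs.
From HB Require Import structures.
From mathcomp Require Import all_boot all_order all_algebra.
From mathcomp Require Import all_classical all_reals all_analysis.
From mathcomp Require Import ring lra.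
Import Order.TTheory GRing.Theory Num.Theory.
(* [coord] and [dom] are shadowed by mathcomp. *)
Import numFieldNormedType.Exports Defs.

Set Implicit Arguments.
Unset Strict Implicit.
Unset Printing Implicit Defensive.

Local Open Scope classical_set_scope.
Local Open Scope ring_scope.

(** * Maps of class C^k *)

(** The formula for [tau] is short; making it global is the work. Fibres over p are read in a
    preferred chart that depends on p without any continuity, so an expression given pointwise
    cannot be differentiated as it stands: each smoothness or derivative statement is moved to a
    fixed chart by a transformation law. For [tau] no such law is visible, because neither [Gamma]
    nor the directions of differentiation inside it are tensorial separately; hence the detour
    through test functions with a prescribed 2-jet. These need to exist only near one point, so
    germs suffice and no bump functions occur. The same concern shapes the linear case. Linearity of
    A itself would require extending every 1-jet to a global function. The derivative of A along the
    zero section is linear for any smooth A, and on the jet of a global function the homogeneity of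
    D already identifies it with A. Smoothness is defined by iterated directional derivatives, so
    the chain rule in finite dimension and the symmetry of second derivatives are obtained from that
    definition. *)

Section Ck_basic.
Context {R : realType}.
Implicit Types (V W : normedModType R).

Lemma Ck_continuous V W k (U : set V) (f : V -> W) :
  Ck k U f -> forall x, U x -> {for x, continuous f}.
Proof. by case: k => [|k] []. Qed.

Lemma open_near V (U : set V) x (P : V -> Prop) :
  open U -> U x -> (forall y, U y -> P y) -> \near x, P x.
Proof.
by move=> oU Ux UP; apply: filterS UP _; exact: open_nbhs_nbhs.
Qed.

(** Openness makes the two functions agree near each point of [U], so limits and derivatives
    coincide. This is how a formula valid only on a chart domain is substituted under [Ck]. *)
Lemma Ck_eq V W k (U : set V) (f g : V -> W) : open U ->
  (forall x, U x -> f x = g x) -> Ck k U f -> Ck k U g.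
Proof.
move=> oU; elim: k f g => [|k IH] f g fg /= [cf df]; split.
- move=> x Ux; rewrite /prop_for /continuous_at -fg //.
  by apply: cvg_trans (cf x Ux); apply: near_eq_cvg; exact: open_near oU Ux fg.
- by [].
- move=> x Ux; rewrite /prop_for /continuous_at -fg //.
  by apply: cvg_trans (cf x Ux); apply: near_eq_cvg; exact: open_near oU Ux fg.
- move=> v; have [dfv cfv] := df v; split.
    move=> x Ux; apply: near_eq_derivable (dfv x Ux).
    exact: open_near oU Ux fg.
  apply: IH cfv => x Ux; apply: near_eq_derive; exact: open_near oU Ux fg.
Qed.

Lemma Ck_sub V W k (U U' : set V) (f : V -> W) : U' `<=` U ->
  Ck k U f -> Ck k U' f.
Proof.
move=> sU; elim: k f => [|k IH] f /= [cf df]; split => //;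
  try by move=> x /sU; exact: cf.
move=> v; have [dfv cfv] := df v; split; last exact: IH.
by move=> x /sU; exact: dfv.
Qed.

Lemma CkS V W k (U : set V) (f : V -> W) : Ck k.+1 U f -> Ck k U f.
Proof.
elim: k f => [|k IH] f [cf df]; split => // v.
by have [dfv cfv] := df v; split => //; exact: IH.
Qed.

Lemma Ck1 V W k (U : set V) (f : V -> W) : Ck k.+1 U f -> Ck 1 U f.
Proof. by elim: k => [//|k IH /CkS]; exact: IH. Qed.

Lemma Ck_cst V W k (U : set V) (w : W) : Ck k U (cst w : V -> W).
Proof.
elim: k w => [|k IH] w; split => //; try by move=> x _; exact: cvg_cst.
move=> v; split => [x _|]; first exact: derivable_cst.
suff -> : (fun x => 'D_v (cst w : V -> W) x) = cst 0 by exact: IH.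
by apply/funext => x; exact: derive_cst.
Qed.

Lemma CkD V W k (U : set V) (f g : V -> W) : open U ->
  Ck k U f -> Ck k U g -> Ck k U (fun x => f x + g x).
Proof.
move=> oU; elim: k f g => [|k IH] f g /= [cf df] [cg dg]; split => //;
  try by move=> x Ux; apply: cvgD; [exact: cf|exact: cg].
move=> v; have [dfv cfv] := df v; have [dgv cgv] := dg v; split.
  by move=> x Ux; apply: derivableD; [exact: dfv|exact: dgv].
apply: Ck_eq (IH _ _ cfv cgv) => // x Ux.
by rewrite -[RHS]/('D_v (f + g) x) deriveD //; [exact: dfv|exact: dgv].
Qed.

Lemma Ck_sum V W k (U : set V) (I : Type) (r : seq I) (P : pred I)
    (f : I -> V -> W) : open U ->
  (forall i, P i -> Ck k U (f i)) -> Ck k U (fun x => \sum_(i <- r | P i) f i x).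
Proof.
move=> oU cf; elim: r => [|i r IH].
  apply: Ck_eq (@Ck_cst V W k U 0) => // x _; by rewrite big_nil.
apply: (@Ck_eq _ _ _ _ (fun x => (if P i then f i x else 0) +
   \sum_(i <- r | P i) f i x)) => //.
  by move=> x _; rewrite big_cons; case: ifP => // _; rewrite add0r.
apply: CkD => //; case: (P i) (cf i) => [Pi|_]; first exact: Pi.
exact: Ck_cst.
Qed.

(** A continuous linear map passes through the limit of the difference quotient, so directional
    derivability of [f] is enough and no differential has to exist. *)
Lemma is_derive_comp_linear V W W' (l : {linear W -> W'}) (f : V -> W) x v :
  continuous l -> derivable f x v ->
  is_derive x v (l \o f) (l ('D_v f x)).
Proof.
move=> cl df; have H : (fun h => h^-1 *: (((l \o f) \o shift x) (h *: v) -
    (l \o f) x)) @ 0^' --> l ('D_v f x).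
  rewrite (_ : (fun h => _) = l \o (fun h => h^-1 *: ((f \o shift x) (h *: v) - f x))).
    by apply: continuous_cvg; [exact: cl|exact: df].
    by apply/funext => h /=; rewrite -linearB -linearZZ.
apply: DeriveDef; last exact: cvg_lim.
by apply/cvg_ex; exists (l ('D_v f x)).
Qed.

Lemma Ck_comp_linear V W W' k (U : set V) (l : {linear W -> W'}) (f : V -> W) :
  open U -> continuous l -> Ck k U f -> Ck k U (l \o f).
Proof.
move=> oU cl; elim: k f => [|k IH] f /= [cf df]; split => //;
  try by move=> x Ux; apply: continuous_comp; [exact: cf|exact: cl].
move=> v; have [dfv cfv] := df v; split.
  by move=> x Ux; have [] := is_derive_comp_linear cl (dfv x Ux).
apply: Ck_eq (IH _ cfv) => // x Ux /=.
by have := is_derive_comp_linear cl (dfv x Ux) => ?; rewrite derive_val.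
Qed.

Lemma Ck_linear V W k (U : set V) (l : {linear V -> W}) : open U ->
  continuous l -> Ck k U l.
Proof.
move=> oU cl; case: k => [|k]; split => //; try by move=> x _; exact: cl.
have dl x v : is_derive x v l (l v).
  have := is_derive_comp_linear (f := id) cl (@derivable_id _ _ x v).
  by rewrite derive_id.
move=> v; split => [x _|]; first by have [] := dl x v.
apply: Ck_eq (@Ck_cst V W k U (l v)) => // x _.
by have := dl x v => ?; rewrite derive_val.
Qed.

Lemma CkM V k (U : set V) (f g : V -> R^o) : open U ->
  Ck k U f -> Ck k U g -> Ck k U (fun x => f x * g x : R^o).
Proof.
move=> oU; elim: k f g => [|k IH] f g cfg1 cfg2; split => //;
  try by move=> x Ux; apply: cvgM;
    [exact: Ck_continuous cfg1 x Ux|exact: Ck_continuous cfg2 x Ux].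
move=> v; have [cf] := cfg1; have [cg] := cfg2.
move=> /(_ v)[dgv cgv] /(_ v)[dfv cfv]; split.
  by move=> x Ux; apply: derivableM; [exact: dfv|exact: dgv].
have H := CkD oU (IH _ _ (CkS cfg1) cgv) (IH _ _ (CkS cfg2) cfv).
apply: Ck_eq H => // x Ux.
by rewrite -[RHS]/('D_v (f * g : V -> R) x) deriveM//; [exact: dfv|exact: dgv].
Qed.

Lemma CkV V k (U : set V) (f : V -> R^o) : open U ->
  (forall x, U x -> f x != 0) ->
  Ck k U f -> Ck k U (fun x => (f x)^-1 : R^o).
Proof.
move=> oU f0; elim: k => [|k IH] cf; split => //;
  try by move=> x Ux; apply: cvgV; [exact: f0|exact: Ck_continuous cf x Ux].
move=> v; have [_] := cf; move=> /(_ v)[dfv cfv]; split.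
  by move=> x Ux; apply: derivableV; [exact: f0|exact: dfv].
have IHf := IH (CkS cf).
have H := CkM oU (CkM oU (CkM oU (Ck_cst k U (-1 : R^o)) IHf) IHf) cfv.
apply: Ck_eq H => // x Ux.
rewrite deriveV; [|exact: f0|exact: dfv].
by rewrite /= mulN1r mulNr expr2 invfM.
Qed.

End Ck_basic.

(** An expansion of every vector in explicit continuous coordinates. As a class it is inferred for
    products and matrices, the shapes of all fibres here; it is what turns continuous directional
    derivatives into differentiability. *)
Class fin_dim (R : realType) (V : normedModType R) := FinDim {
  fdim : nat;
  fvec : 'I_fdim -> V;
  fcoord : 'I_fdim -> {linear V -> R^o};
  fcoord_continuous : forall i, continuous (fcoord i);
  fcoordE : forall x, x = \sum_i fcoord i x *: fvec i }.

#[local] Obligation Tactic := idtac.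

#[global] Program Instance fin_dim_R (R : realType) : fin_dim R^o :=
  @FinDim R R^o 1 (fun=> 1) (fun=> idfun) _ _.
Next Obligation. by move=> R i x; exact: cvg_id. Qed.
Next Obligation. by move=> R x; rewrite big_ord1 /= [_ *: _]mulr1. Qed.

Section fin_dim_mx.
Context {R : realType} {m n : nat}.

Definition mx_coord (ij : 'I_m * 'I_n) (A : 'M[R]_(m, n)) : R^o := A ij.1 ij.2.

Lemma mx_coord_linear ij : linear (mx_coord ij).
Proof. by move=> a u v; rewrite /mx_coord !mxE. Qed.

HB.instance Definition _ ij :=
  GRing.isLinear.Build R 'M[R]_(m, n) R^o _ (mx_coord ij) (mx_coord_linear ij).

#[global] Program Instance fin_dim_mx : fin_dim 'M[R]_(m, n) :=
  @FinDim R 'M[R]_(m, n) #|{: 'I_m * 'I_n}|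
    (fun k => delta_mx (enum_val k).1 (enum_val k).2)
    (fun k => mx_coord (enum_val k)) _ _.
Next Obligation. by move=> k x; exact: coord_continuous. Qed.
Next Obligation.
move=> x; rewrite [LHS]matrix_sum_delta pair_big /=.
by rewrite (reindex (enum_val : 'I_#|{: 'I_m * 'I_n}| -> _)) //=;
  exact: (onW_bij _ (@enum_val_bij _)).
Qed.

End fin_dim_mx.

Section fin_dim_pair.
Context {R : realType} (V W : normedModType R) {fV : fin_dim V} {fW : fin_dim W}.

Definition pair_vec (k : 'I_(fdim (V := V) + fdim (V := W))) : V * W :=
  match fintype.split k with inl i => (fvec i, 0) | inr j => (0, fvec j) end.

Definition pair_coord (k : 'I_(fdim (V := V) + fdim (V := W))) (x : V * W) : R^o :=
  match fintype.split k with inl i => fcoord i x.1 | inr j => fcoord j x.2 end.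

Lemma pair_coord_linear k : linear (pair_coord k).
Proof.
by move=> a u v; rewrite /pair_coord; case: fintype.split => i /=; rewrite linearP.
Qed.

HB.instance Definition _ k :=
  GRing.isLinear.Build R (V * W)%type R^o _ (pair_coord k) (pair_coord_linear k).

#[global] Program Instance fin_dim_pair : fin_dim (V * W)%type :=
  @FinDim R (V * W)%type _ pair_vec (fun k => pair_coord k) _ _.
Next Obligation.
move=> k x; rewrite /continuous_at /= /pair_coord; case: (fintype.split k) => i.
  by apply: (cvg_comp _ _ (@cvg_fst _ _ _ _ _)); exact: fcoord_continuous.
by apply: (cvg_comp _ _ (@cvg_snd _ _ _ _ _)); exact: fcoord_continuous.
Qed.
Next Obligation.
move=> x.
have sumE (F : 'I_(fdim (V := V) + fdim (V := W)) -> V * W) :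
    \sum_k F k = (\sum_k (F k).1, \sum_k (F k).2).
  by rewrite [LHS]surjective_pairing; congr (_, _); apply: big_morph.
rewrite sumE !big_split_ord /= [LHS]surjective_pairing.
congr (_, _).
  rewrite [X in _ + X]big1 ?addr0 => [|i _]; last first.
    by rewrite /pair_vec (unsplitK (inr i)) /= scaler0.
  rewrite [LHS]fcoordE; apply: eq_bigr => i _.
  by rewrite /pair_coord /pair_vec (unsplitK (inl i)).
rewrite [X in X + _]big1 ?add0r => [|i _]; last first.
  by rewrite /pair_vec (unsplitK (inl i)) /= scaler0.
rewrite [LHS]fcoordE; apply: eq_bigr => i _.
by rewrite /pair_coord /pair_vec (unsplitK (inr i)).
Qed.

End fin_dim_pair.

(** * Mean value estimates and differentiability of C^1 functions *)

Section mean_value.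
Context {R : realType}.
Implicit Types (V W : normedModType R).

Lemma is_derive_line V W (f : V -> W) (z e : V) (s : R) :
  derivable f (s *: e + z) e ->
  is_derive s (1 : R) (fun t : R => f (t *: e + z)) ('D_e f (s *: e + z)).
Proof.
have E : (fun h : R => h^-1 *: (((fun t : R => f (t *: e + z)) \o shift s) (h *: (1 : R)) -
     f (s *: e + z))) =
   (fun h : R => h^-1 *: ((f \o shift (s *: e + z)) (h *: e) - f (s *: e + z))).
  by apply/funext => h /=; rewrite [h *: 1]mulr1 scalerDl addrA.
by move=> df; apply: DeriveDef; rewrite /derivable /derive E.
Qed.

(** Absolute values let one statement serve both signs of [t]. *)
Lemma line_MVT V (f : V -> R^o) (z e : V) (t : R) :
  (forall s, `|s| <= `|t| -> derivable f (s *: e + z) e) ->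
  exists2 c, `|c| <= `|t| & f (t *: e + z) - f z = t * 'D_e f (c *: e + z).
Proof.
move=> df; pose g (s : R) : R := f (s *: e + z).
pose dg (s : R) : R := 'D_e f (s *: e + z).
have dgE s : `|s| <= `|t| -> is_derive (s : R) (1 : R) g (dg s).
  by move=> st; apply: is_derive_line; exact: df.
have cg a b : (forall s, s \in `[a, b]%R -> `|s| <= `|t|) ->
    {within `[a, b], continuous g}.
  move=> ab; apply: derivable_within_continuous => s sab.
  by have := dgE s (ab s sab) => ?.
have fE : f z = g 0 by rewrite /g scale0r add0r.
rewrite fE -/(g t); case: (lerP 0 t) => t0.
  have sub s : s \in `[0, t]%R -> `|s| <= `|t|.
    by rewrite in_itv /= => /andP[s0 st]; rewrite !ger0_norm.
  have [|c cI H] := MVT_segment t0 _ (cg _ _ sub) (df := dg).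
    by move=> s /subset_itv_oo_cc /sub; exact: dgE.
  by exists c; [exact: sub|rewrite H subr0 mulrC].
have sub s : s \in `[t, 0]%R -> `|s| <= `|t|.
  by rewrite in_itv /= => /andP[s0 st]; rewrite !ler0_norm ?lerN2 // ltW.
have [|c cI H] := MVT_segment (ltW t0) _ (cg _ _ sub) (df := dg).
  by move=> s /subset_itv_oo_cc /sub; exact: dgE.
exists c; first exact: sub.
by rewrite -opprB H sub0r mulrN opprK mulrC.
Qed.

Lemma differentiable_expansion V W (f : V -> W) (df : {linear V -> W}) x :
  continuous df -> f \o shift x = cst (f x) + df +o_ 0 id ->
  differentiable f x.
Proof.
move=> cdf E; apply/diff_locallyP.
by rewrite (diff_unique cdf E).
Qed.

(** The mean value theorem and continuity of the derivative at [x] give a bound uniform in the base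
    point [z]. Uniformity is what later allows the coordinates to be moved one at a time. *)
Lemma increment_estimate V (f : V -> R^o) (e x : V) :
  (\near x, derivable f x e) -> {for x, continuous ('D_e f)} ->
  forall eps, 0 < eps -> exists2 d, 0 < d & forall z t,
    `|z - x| < d -> `|t *: e| < d ->
    `|f (t *: e + z) - f z - t * 'D_e f x| <= eps * `|t|.
Proof.
move=> df cf eps eps0.
have /nbhs_ballP[d1 /= d10 H1] := df.
have /cvgrPdist_le /(_ eps eps0) /nbhs_ballP[d2 /= d20 H2] := cf.
(* Half for the distance from [z] to [x], half for the displacement: the whole segment stays in both
   balls. *)
exists (Num.min d1 d2 / 2); first by rewrite divr_gt0 // lt_min d10.
move=> z t zx te.
have near s : `|s| <= `|t| -> `|x - (s *: e + z)| < Num.min d1 d2.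
  move=> st; rewrite distrC -addrA (le_lt_trans (ler_normD _ _)) //.
  rewrite (splitr (Num.min _ _)) ler_ltD // (le_trans _ (ltW te)) //.
  by rewrite !normrZ ler_wpM2r.
have [|c ct ->] := @line_MVT _ f z e t.
  move=> s st; apply: H1; rewrite -ball_normE /=.
  by apply: lt_le_trans (near s st) _; rewrite ge_min lexx.
rewrite -mulrBr normrM mulrC ler_wpM2r // distrC; apply: H2.
rewrite -ball_normE /=.
by apply: lt_le_trans (near c ct) _; rewrite ge_min lexx orbT.
Qed.

End mean_value.

Lemma continuous_sum (R : realType) (V W : normedModType R) (I : Type)
    (r : seq I) (F : I -> V -> W) :
  (forall i, continuous (F i)) -> continuous (fun x => \sum_(i <- r) F i x).
Proof.
move=> cF x; have [//|H _] := @Ck_sum R V W 0 setT I r xpredT F openT.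
  by move=> i _; split => // y _; exact: cF.
exact: H.
Qed.

Section real_valued.
Context {R : realType} (V : normedModType R) {fV : fin_dim V}.

Definition grad_map (f : V -> R^o) (x h : V) : R^o :=
  \sum_i fcoord i h * 'D_(fvec i) f x.

Lemma grad_map_linear f x : linear (grad_map f x).
Proof.
move=> a u v; rewrite /grad_map scaler_sumr -big_split; apply: eq_bigr => i _.
by rewrite linearP /= mulrDl -[a *: _]/(a * _) -[a *: _]/(a * _) mulrA.
Qed.

HB.instance Definition _ f x :=
  GRing.isLinear.Build R V R^o _ (grad_map f x) (grad_map_linear f x).

Lemma grad_map_continuous f x : continuous (grad_map f x).
Proof.
apply: continuous_sum => i h.
by apply: cvgM; [exact: fcoord_continuous|exact: cvg_cst].
Qed.

Lemma C1_differentiable_real (U : set V) (f : V -> R^o) x : open U -> Ck 1 U f -> U x ->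
  differentiable f x.
Proof.
move=> oU [cf df] Ux; apply: (@differentiable_expansion _ _ _ _ (grad_map f x)).
  exact: grad_map_continuous.
apply/eqaddoP => eps eps0.
(* Generalised to a list of coordinates, for an induction that moves one coordinate at a time: the
   new increment starts at [S + x], which tends to [x] with [h], so the uniform estimate applies
   there. *)
suff H (r : seq 'I_(@fdim _ _ fV)) : forall eps, 0 < eps -> \forall h \near (0 : V),
    `|f (\sum_(i <- r) fcoord i h *: fvec i + x) -
      (f x + \sum_(i <- r) fcoord i h * 'D_(fvec i) f x)| <= eps * `|h|.
  move: (H (index_enum _) _ eps0); apply: filterS => h.
  by rewrite /= -fcoordE.
elim: r => [|i r IH] {}eps {}eps0.
  apply: nearW => h; rewrite !big_nil add0r addr0 subrr normr0.
  by rewrite mulr_ge0 // ltW.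
(* The coordinate is bounded by [k] times the norm of [h], hence the tolerance [eps / 2 / k] for its
   increment; the other half of [eps] goes to the induction hypothesis. *)
have [k k0 Hk] := linear_lipschitz (@fcoord_continuous _ _ fV i).
have e2k : 0 < eps / 2 / k by rewrite !divr_gt0.
have dnear : \near x, derivable f x (fvec i).
  by apply: (open_near oU Ux) => y Uy; exact: (df _).1.
have [d d0 Hd] := @increment_estimate _ _ f (fvec i) x dnear
  ((df _).2.1 _ Ux) _ e2k.
have cT j : continuous (fun h : V => fcoord j h *: fvec j : V).
  by move=> h; apply: cvgZ; [exact: fcoord_continuous|exact: cvg_cst].
have cS := continuous_sum (r := r) cT.
have S0 : (fun h : V => \sum_(j <- r) fcoord j h *: fvec j) @ 0 --> (0 : V).
  have := cS 0; rewrite /continuous_at big1 // => j _.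
  by rewrite linear0 scale0r.
have T0 : (fun h : V => fcoord i h *: fvec i) @ 0 --> (0 : V).
  by have := cT i 0; rewrite /continuous_at linear0 scale0r.
have e2 : 0 < eps / 2 by rewrite divr_gt0.
near=> h.
rewrite !big_cons.
set S := \sum_(j <- r) fcoord j h *: _.
set T := \sum_(j <- r) fcoord j h * _.
rewrite (_ : f _ - _ = (f (fcoord i h *: fvec i + (S + x)) - f (S + x) -
   fcoord i h * 'D_(fvec i) f x) + (f (S + x) - (f x + T))); last first.
  by rewrite -[in LHS](addrA (_ *: _)); ring.
rewrite (le_trans (ler_normD _ _)) // (splitr eps) mulrDl lerD //; last first.
  by rewrite /S /T; near: h; exact: IH.
apply: (@le_trans _ _ (eps / 2 / k * `|fcoord i h|)); last first.
  rewrite -(mulrA (eps / 2)); apply: ler_wpM2l; first exact: ltW.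
  by rewrite ler_pdivrMl // Hk.
apply: Hd.
  by rewrite addrK /S; near: h; exact: cvgr0_norm_lt S0 d d0.
by near: h; exact: cvgr0_norm_lt T0 d d0.
Unshelve. all: by end_near. Qed.

End real_valued.

(** * Chain rule and stability of C^k maps under algebraic operations *)

Section Ck_composition.
Context {R : realType}.
Implicit Types (X V W : normedModType R).

Lemma Ck_fcoord X W {fW : fin_dim W} k (U : set X) (f : X -> W) : open U ->
  (forall i : 'I_(@fdim _ _ fW), Ck k U (fcoord i \o f : X -> R^o)) <-> Ck k U f.
Proof.
move=> oU; split => [cf|cf i]; last first.
  by apply: Ck_comp_linear => //; exact: fcoord_continuous.
apply: (@Ck_eq _ _ _ _ _ (fun x => \sum_i fcoord i (f x) *: fvec i)) => //.
  by move=> x _; rewrite -fcoordE.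
apply: Ck_sum => // i _.
pose l (r : R^o) : W := r *: fvec i.
have linl : linear l by move=> a u v; rewrite /l scalerDl scalerA.
pose lM := GRing.isLinear.Build _ _ _ _ _ linl.
pose lL : {linear _ -> _} := HB.pack l lM.
apply: (@Ck_comp_linear _ _ _ _ k U lL (fcoord i \o f)) => //.
exact: scalel_continuous.
Qed.

Lemma C1_differentiable V W {fV : fin_dim V} {fW : fin_dim W} (U : set V)
    (f : V -> W) x :
  open U -> Ck 1 U f -> U x -> differentiable f x.
Proof.
move=> oU cf Ux.
have -> : f = \sum_(i < @fdim _ _ fW) (fun x => fcoord i (f x) *: fvec i).
  by apply/funext => y; rewrite fct_sumE -fcoordE.
apply: differentiable_sum => i.
apply: (@differentiableZl _ _ _ (fcoord i \o f)).
apply: (C1_differentiable_real oU _ Ux).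
exact: (Ck_comp_linear oU (@fcoord_continuous _ _ fW i) cf).
Qed.

Lemma derive_fcoord V W {fV : fin_dim V} (f : V -> W) x w :
  differentiable f x ->
  'D_w f x = \sum_i fcoord i w *: 'D_(fvec i) f x.
Proof.
move=> df; rewrite deriveE // {1}[w]fcoordE linear_sum; apply: eq_bigr => i _.
by rewrite linearZ deriveE.
Qed.

(** [G] has only a derivative along [v]. Restricted to the line through [x], derivability and
    differentiability agree, and the chain rule for differentials applies to the restriction. *)
Lemma is_derive_comp X V W (F : V -> W) (G : X -> V) x v :
  derivable G x v -> differentiable F (G x) ->
  is_derive x v (F \o G) ('D_('D_v G x) F (G x)).
Proof.
move=> dG dF; pose g (t : R) := G (t *: v + x).
have x0 : 0 *: v + x = x by rewrite scale0r add0r.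
have dg0 : is_derive (0 : R) (1 : R) g ('D_v G x).
  by have := @is_derive_line _ _ _ G x v 0; rewrite x0; exact.
have dg : differentiable g (0 : R) by apply/derivable1_diffP.
have g0 : g 0 = G x by rewrite /g x0.
have dFg : differentiable F (g 0) by rewrite g0.
have dFG : derivable (F \o G) x v.
  by apply/derivable1P/derivable1_diffP; exact: differentiable_comp dg dFg.
apply: DeriveDef => //.
have := @is_derive_line _ _ _ (F \o G) x v 0; rewrite x0 => /(_ dFG) H.
rewrite -(@derive_val _ _ _ _ _ _ _ H).
rewrite deriveE; last exact: differentiable_comp dg dFg.
rewrite -[fun t : R => _]/(F \o g) diff_comp //= g0 deriveE //; congr ('d F _ _).
by rewrite -deriveE // derive_val.
Qed.

(** The derivative of the composite is expanded over the fixed directions [fvec i]: the induction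
    hypothesis, with [F] general, applies to each partial derivative of [F], whereas the direction
    ['D_v G x] varies with the point. *)
Lemma Ck_comp_real X V {fV : fin_dim V} k (U : set X) (O : set V)
    (F : V -> R^o) (G : X -> V) : open U -> open O ->
  (forall x, U x -> O (G x)) -> Ck k O F -> Ck k U G -> Ck k U (F \o G).
Proof.
move=> oU oO UO; elim: k F => [|k IH] F cF cG; split => //;
  try by move=> x Ux; apply: continuous_comp;
    [exact: Ck_continuous cG x Ux|exact: Ck_continuous cF _ (UO x Ux)].
have c1F := Ck1 cF.
have dF y : O y -> differentiable F y by exact: C1_differentiable.
move=> v; have [dGv cGv] := (cG.2 v); split.
  by move=> x Ux; have [] := is_derive_comp (dGv x Ux) (dF _ (UO x Ux)).
apply: (@Ck_eq _ _ _ _ _ (fun x => \sum_i fcoord i ('D_v G x) *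
     ('D_(fvec i) F (G x)) : R^o)) => //.
  move=> x Ux; have [_ ->] := is_derive_comp (dGv x Ux) (dF _ (UO x Ux)).
  by rewrite [RHS]derive_fcoord //; exact: dF (UO x Ux).
apply: Ck_sum => // i _; apply: CkM => //.
  by apply: Ck_comp_linear => //; exact: fcoord_continuous.
by apply: (IH (fun y => 'D_(fvec i) F y)); [exact: (cF.2 (fvec i)).2|exact: CkS].
Qed.

Lemma Ck_comp X V W {fV : fin_dim V} {fW : fin_dim W} k (U : set X) (O : set V)
    (F : V -> W) (G : X -> V) : open U -> open O ->
  (forall x, U x -> O (G x)) -> Ck k O F -> Ck k U G -> Ck k U (F \o G).
Proof.
move=> oU oO UO cF cG; apply/(Ck_fcoord _ _ oU) => i.
have cFi := (Ck_fcoord k F oO).2 cF i.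
exact: (Ck_comp_real oU oO UO cFi cG).
Qed.

(** Differentiation in a direction that moves with the point costs one order of [F] and none of [G]
    and [w]. Both [jet3] and the fibre derivative of a bundle map have this form. *)
Lemma Ck_derive_along X V {fV : fin_dim V} k (U : set X) (O : set V)
    (F : V -> R^o) (G w : X -> V) : open U -> open O ->
  (forall x, U x -> O (G x)) -> Ck k.+1 O F -> Ck k U G -> Ck k U w ->
  Ck k U (fun x => 'D_(w x) F (G x)).
Proof.
move=> oU oO UO cF cG cw.
have c1F := Ck1 cF.
apply: (@Ck_eq _ _ _ _ _ (fun x => \sum_i fcoord i (w x) *
     ('D_(fvec i) F (G x)) : R^o)) => //.
  by move=> x Ux; rewrite [RHS]derive_fcoord //; apply: C1_differentiable c1F (UO x Ux).
apply: Ck_sum => // i _; apply: CkM => //.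
  by apply: Ck_comp_linear => //; exact: fcoord_continuous.
exact: (Ck_comp_real oU oO UO (cF.2 (fvec i)).2 cG).
Qed.

Lemma Ck_pair X V W k (U : set X) (f : X -> V) (g : X -> W) : open U ->
  Ck k U f -> Ck k U g -> Ck k U (fun x => (f x, g x)).
Proof.
move=> oU cf cg.
pose l1 (v : V) : (V * W)%type := (v, 0); pose l2 (w : W) : (V * W)%type := (0, w).
have linl1 : linear l1 by move=> a u v; congr (_, _); rewrite /= scaler0 addr0.
have linl2 : linear l2 by move=> a u v; congr (_, _); rewrite /= scaler0 addr0.
pose L1 : {linear _ -> _} := HB.pack l1 (GRing.isLinear.Build _ _ _ _ _ linl1).
pose L2 : {linear _ -> _} := HB.pack l2 (GRing.isLinear.Build _ _ _ _ _ linl2).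
have cL1 : continuous L1 by move=> v; apply: cvg_pair; [exact: cvg_id|exact: cvg_cst].
have cL2 : continuous L2 by move=> v; apply: cvg_pair; [exact: cvg_cst|exact: cvg_id].
apply: Ck_eq (CkD oU (Ck_comp_linear oU cL1 cf) (Ck_comp_linear oU cL2 cg)) => //.
by move=> x _; congr (_, _); rewrite /= ?addr0 ?add0r.
Qed.

Lemma Ck_fst X V W k (U : set X) (f : X -> V * W) : open U ->
  Ck k U f -> Ck k U (fun x => (f x).1).
Proof.
move=> oU cf.
have linl : linear (@fst V W) by [].
pose L : {linear _ -> _} := HB.pack (@fst V W) (GRing.isLinear.Build _ _ _ _ _ linl).
by apply: (@Ck_comp_linear _ _ _ _ _ _ L) => // v; exact: cvg_fst.
Qed.

Lemma Ck_snd X V W k (U : set X) (f : X -> V * W) : open U ->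
  Ck k U f -> Ck k U (fun x => (f x).2).
Proof.
move=> oU cf.
have linl : linear (@snd V W) by [].
pose L : {linear _ -> _} := HB.pack (@snd V W) (GRing.isLinear.Build _ _ _ _ _ linl).
by apply: (@Ck_comp_linear _ _ _ _ _ _ L) => // v; exact: cvg_snd.
Qed.

Lemma Ck_entry X m n k (U : set X) (f : X -> 'M[R]_(m, n)) i j : open U ->
  Ck k U f -> Ck k U (fun x => f x i j : R^o).
Proof.
move=> oU cf; apply: (@Ck_comp_linear _ _ _ _ _ _ (mx_coord (i, j))) => // v.
exact: coord_continuous.
Qed.

Lemma Ck_mx X m n k (U : set X) (f : X -> 'M[R]_(m, n)) : open U ->
  (forall i j, Ck k U (fun x => f x i j : R^o)) -> Ck k U f.
Proof. by move=> oU cf; apply/(Ck_fcoord _ _ oU) => i; exact: cf. Qed.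

Lemma Ck_prod X k (U : set X) (I : Type) (r : seq I) (f : I -> X -> R^o) :
  open U -> (forall i, Ck k U (f i)) ->
  Ck k U (fun x => \prod_(i <- r) f i x : R^o).
Proof.
move=> oU cf; elim: r => [|i r IH].
  by apply: Ck_eq (Ck_cst k U (1 : R^o)) => // x _; rewrite big_nil.
by apply: Ck_eq (CkM oU (cf i) IH) => // x _; rewrite big_cons.
Qed.

Lemma Ck_det X n k (U : set X) (f : X -> 'M[R]_n) : open U ->
  Ck k U f -> Ck k U (fun x => \det (f x) : R^o).
Proof.
move=> oU cf; rewrite /determinant; apply: Ck_sum => // s _.
apply: CkM => //; first exact: Ck_cst.
by apply: Ck_prod => // i; exact: Ck_entry.
Qed.

Lemma Ck_invmx X n k (U : set X) (f : X -> 'M[R]_n) : open U ->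
  (forall x, U x -> f x \in unitmx) ->
  Ck k U f -> Ck k U (fun x => invmx (f x)).
Proof.
move=> oU uf cf; apply: Ck_mx => // i j.
(* Cramer's formula: the (i, j) entry of the inverse is the (j, i) cofactor divided by the
   determinant. *)
apply: (@Ck_eq _ _ _ _ _ (fun x => (\det (f x))^-1 *
    ((-1) ^+ (j + i) * \det (row' j (col' i (f x)))) : R^o)) => //.
  by move=> x Ux; rewrite /invmx uf // !mxE.
apply: CkM => //.
  apply: CkV => //; last exact: Ck_det.
  by move=> x Ux; rewrite -unitfE -unitmxE uf.
apply: CkM => //; first exact: Ck_cst.
apply: Ck_det => //; apply: Ck_mx => // a b.
by apply: Ck_eq (Ck_entry (lift j a) (lift i b) oU cf) => // x _; rewrite !mxE.
Qed.

End Ck_composition.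

(** * Symmetry of second derivatives *)

Section mixed_derivatives.
Context {R : realType} (V : normedModType R).

Lemma is_derive_shift_arg (f : V -> R^o) (a z v : V) : derivable f (a + z) v ->
  is_derive z v (fun y => f (a + y)) ('D_v f (a + z)).
Proof.
have E : (fun h : R => h^-1 *: (((fun y => f (a + y)) \o shift z) (h *: v) -
     f (a + z))) = (fun h : R => h^-1 *: ((f \o shift (a + z)) (h *: v) - f (a + z))).
  by apply/funext => h /=; rewrite addrCA.
by move=> df; apply: DeriveDef; rewrite /derivable /derive E.
Qed.

Lemma dist_le_half (A B C eps : R) :
  `|A - C| <= eps / 2 -> `|B - C| <= eps / 2 -> `|A - B| <= eps.
Proof.
move=> AC BC; rewrite -(subrKA C) [leRHS]splitr.
by rewrite (le_trans (ler_normD _ _)) // lerD // distrC.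
Qed.

(* The left-hand side is symmetric in [v] and [w] while the right-hand side tends
   to [t ^+ 2 * 'D_w ('D_v f) x]. *)
Lemma second_difference (f : V -> R^o) (x v w : V) (t : R) :
  (forall a b, `|a| <= `|t| -> `|b| <= `|t| ->
     derivable f (b *: w + (a *: v + x)) v /\
     derivable ('D_v f) (b *: w + (a *: v + x)) w) ->
  exists a b, [/\ `|a| <= `|t|, `|b| <= `|t| &
    f (t *: w + (t *: v + x)) - f (t *: v + x) - (f (t *: w + x) - f x) =
    t * (t * 'D_w ('D_v f) (b *: w + (a *: v + x)))].
Proof.
move=> df; pose g (z : V) : R^o := f (t *: w + z) - f z.
have dg a : `|a| <= `|t| -> is_derive (a *: v + x) v g
   ('D_v f (t *: w + (a *: v + x)) - 'D_v f (a *: v + x)).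
  move=> at_; have [d1 _] := df a t at_ (lexx _).
  have := df a 0 at_; rewrite normr0 scale0r add0r => /(_ (normr_ge0 _))[d2 _].
  have := is_derive_shift_arg d1 => ?.
  by apply: is_deriveB; exact: derivableP.
have [a ta ga] := @line_MVT _ _ g x v t (fun s st => let: DeriveDef d _ := dg s st in d).
have [b tb gb] := @line_MVT _ _ ('D_v f) (a *: v + x) w t
  (fun s st => (df a s ta st).2).
exists a, b; split => //.
rewrite -[LHS]/(g (t *: v + x) - g x) ga; congr (_ * _).
by have [_ ->] := dg a ta.
Qed.

(** Evaluating one second difference in both orders shows that the two mixed derivatives take a
    common value at two points as close to [x] as desired; continuity of both brings the equality to
    [x]. *)
Lemma derive_comm (U : set V) (f : V -> R^o) x v w : open U -> Ck 2 U f -> U x ->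
  'D_v ('D_w f) x = 'D_w ('D_v f) x.
Proof.
move=> oU cf Ux; apply/eqP; rewrite -subr_eq0 -normr_le0.
apply/ler_addgt0Pl => eps eps0; rewrite addr0.
have e2 : 0 < eps / 2 by rewrite divr_gt0.
have cvw : {for x, continuous ('D_v ('D_w f))} := ((cf.2 w).2.2 v).2.1 x Ux.
have cwv : {for x, continuous ('D_w ('D_v f))} := ((cf.2 v).2.2 w).2.1 x Ux.
have /cvgrPdist_le /(_ _ e2) /nbhs_ballP[d1 /= d10 H1] := cvw.
have /cvgrPdist_le /(_ _ e2) /nbhs_ballP[d2 /= d20 H2] := cwv.
have /nbhs_ballP[d3 /= d30 H3] : nbhs x U by exact: open_nbhs_nbhs.
pose d := Num.min d1 (Num.min d2 d3).
have d0 : 0 < d by rewrite !lt_min d10 d20.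
(* Small enough for the parallelogram spanned by [t *: v] and [t *: w] to stay within [d] of [x];
   the summand 1 keeps the denominator positive when both vectors vanish. *)
pose t := d / (2 * (1 + `|v| + `|w|)).
have nvw : 0 < 1 + `|v| + `|w| by rewrite -addrA ltr_pwDl // addr_ge0.
have t0 : 0 < t by rewrite divr_gt0 // mulr_gt0.
have nt : `|t| = t by rewrite ger0_norm // ltW.
have inball a b : `|a| <= `|t| -> `|b| <= `|t| -> `|x - (b *: w + (a *: v + x))| < d.
  rewrite nt => ha hb; rewrite distrC addrA addrK.
  apply: le_lt_trans (ler_normD _ _) _; rewrite !normrZ.
  apply: (@le_lt_trans _ _ (t * `|w| + t * `|v|)).
    by rewrite lerD // ler_wpM2r.
  apply: (@lt_le_trans _ _ (t * (2 * (1 + `|v| + `|w|)))); last first.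
    by rewrite /t divfK // mulf_neq0 // gt_eqF.
  rewrite -mulrDr ltr_pM2l //.
  have := normr_ge0 v; have := normr_ge0 w; move: (`|v|) (`|w|) => p q; lra.
have sub1 y : `|x - y| < d -> ball x d1 y.
  by move=> H; rewrite -ball_normE /=; apply: lt_le_trans H _; rewrite ge_min lexx.
have sub2 y : `|x - y| < d -> ball x d2 y.
  by move=> H; rewrite -ball_normE /=; apply: lt_le_trans H _; rewrite !ge_min lexx orbT.
have sub3 y : `|x - y| < d -> U y.
  move=> H; apply: H3; rewrite -ball_normE /=.
  by apply: lt_le_trans H _; rewrite !ge_min lexx !orbT.
have [a [b [ha hb E1]]] := @second_difference f x v w t (fun a b ha hb =>
  conj ((cf.2 v).1 _ (sub3 _ (inball a b ha hb)))
       (((cf.2 v).2.2 w).1 _ (sub3 _ (inball a b ha hb)))).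
have inball' a' b' : `|a'| <= `|t| -> `|b'| <= `|t| ->
    `|x - (b' *: v + (a' *: w + x))| < d.
  by move=> h1 h2; rewrite addrCA; exact: inball.
have [a' [b' [ha' hb' E2]]] := @second_difference f x w v t (fun a b ha hb =>
  conj ((cf.2 w).1 _ (sub3 _ (inball' a b ha hb)))
       (((cf.2 w).2.2 v).1 _ (sub3 _ (inball' a b ha hb)))).
have E : 'D_w ('D_v f) (b *: w + (a *: v + x)) =
    'D_v ('D_w f) (b' *: v + (a' *: w + x)).
  have tn0 : t != 0 :> R by rewrite gt_eqF.
  apply: (mulfI tn0); apply: (mulfI tn0).
  apply: (etrans (esym E1)); apply: (etrans _ E2).
  rewrite (addrCA (t *: v) (t *: w) x).
  move: (f (t *: w + (t *: v + x))) (f (t *: v + x)) (f (t *: w + x)) (f x).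
  by move=> A B C D; rewrite -!addrA; congr (_ + _); rewrite !opprB addrCA [RHS]addrCA;
    congr (_ + _); exact: addrC.
have B1 := H1 _ (sub1 _ (inball' a' b' ha' hb')).
have B2 := H2 _ (sub2 _ (inball a b ha hb)).
by rewrite E in B2; exact: dist_le_half B1 B2.
Qed.

End mixed_derivatives.

(** * Smooth germs on a manifold *)

(** Continuity and derivability are conditions at points, so they can be checked on a cover. This
    glues the neighbourhoods supplied by [smooth_at]. *)
Lemma Ck_local (R : realType) (V W : normedModType R) k (U : set V) (f : V -> W) :
  (forall x, U x -> exists O, [/\ open O, O x & Ck k O f]) -> Ck k U f.
Proof.
elim: k f => [|k IH] f H; split => //;
  try by move=> x /H[B [_ Bx cf]]; exact: Ck_continuous cf x Bx.
move=> v; split; first by move=> x /H[B [_ Bx cf]]; exact: (cf.2 v).1.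
by apply: IH => x /H[B [oB Bx cf]]; exists B; split => //; exact: (cf.2 v).2.
Qed.

Lemma near_openE (T : topologicalType) (p : T) (P : T -> Prop) :
  (\forall q \near p, P q) ->
  exists N : set T, [/\ open N, N p & forall q, N q -> P q].
Proof.
move=> pP; have : nbhs p P by exact: pP.
by rewrite nbhsE => -[N [oN Np] NP]; exists N.
Qed.

Section charts.
Context {R : realType} {n : nat} (M : manifold R n).
Implicit Types (i j : atlas M) (p q : M).

Lemma dom_open i : open (dom i). Proof. by case: M i. Qed.
Lemma cdom_open i : open (cdom i). Proof. by case: M i. Qed.
Lemma coordK i p : dom i p -> param i (coord i p) = p.
Proof. by case: M i p => /=. Qed.
Lemma coord_continuous_at i p : dom i p -> {for p, continuous (coord i)}.
Proof. by case: M i p => /=. Qed.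
Lemma param_continuous_at i p : dom i p -> {for coord i p, continuous (param i)}.
Proof. by case: M i p => /=. Qed.
Lemma transition_smooth i j :
  smooth_on (coord j @` (dom i `&` dom j)) (coord i \o param j).
Proof. by case: M i j => /=. Qed.
Lemma chart_at_dom p : dom (chart_at p) p. Proof. by case: M p. Qed.

Lemma paramK i x : cdom i x -> coord i (param i x) = x.
Proof. by case=> p ip <-; rewrite coordK. Qed.

Lemma param_dom i x : cdom i x -> dom i (param i x).
Proof. by case=> p ip <-; rewrite coordK. Qed.

Lemma near_param i p (P : M -> Prop) : dom i p ->
  (\forall q \near p, P q) -> \forall x \near coord i p, P (param i x).
Proof.
by move=> ip pP; apply: (param_continuous_at ip); rewrite coordK.
Qed.

Lemma near_dom i p : dom i p -> \forall q \near p, dom i q.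
Proof. by move=> ip; apply: open_nbhs_nbhs; split => //; exact: dom_open. Qed.

Lemma open_chart_image i (N : set M) : open N -> N `<=` dom i ->
  open (coord i @` N).
Proof.
move=> oN Ni; rewrite openE => _ [p Np <-].
have ip := Ni p Np.
have H1 : \forall x \near coord i p, N (param i x).
  by apply: near_param => //; exact: open_nbhs_nbhs.
have H2 : \forall x \near coord i p, cdom i x.
  by apply: open_nbhs_nbhs; split; [exact: cdom_open|exists p].
rewrite /interior; near=> x; exists (param i x); first by near: x.
by rewrite paramK //; near: x.
Unshelve. all: by end_near. Qed.

(** Smoothness of a germ. Chart expressions such as [coord i] or partial derivatives carry meaning
    only on [dom i], so they are smooth near its points and not as functions on [M]. *)
Definition smooth_at (W : normedModType R) (p : M) (f : M -> W) :=
  exists i N, [/\ open N, N p, N `<=` dom i & smooth_on (coord i @` N) (f \o param i)].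

(** The witnessing chart can be exchanged for any other chart around [p], the transition functions
    being smooth. *)
Lemma smooth_atP (W : normedModType R) {fW : fin_dim W} j p (f : M -> W) :
  smooth_at p f -> dom j p -> exists N, [/\ open N, N p, N `<=` dom j & smooth_on (coord j @` N) (f \o param j)].
Proof.
move=> [i [N [oN Np Ni fs]]] jp; exists (N `&` dom j).
have oNj : open (N `&` dom j) by apply: openI => //; exact: dom_open.
have sNj : N `&` dom j `<=` dom j by move=> q [].
split => // k.
apply: (@Ck_eq _ _ _ _ _ ((f \o param i) \o (coord i \o param j))).
- exact: open_chart_image.
- move=> _ [q [Nq jq] <-] /=; rewrite !coordK //; exact: Ni.
- apply: (Ck_comp _ (open_chart_image oN Ni) _ (fs k)).
  + exact: open_chart_image.
  + by move=> _ [q [Nq jq] <-] /=; exists q => //; rewrite coordK.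
  + apply: Ck_sub (@transition_smooth i j k).
    by move=> _ [q [Nq jq] <-]; exists q => //; split => //; exact: Ni.
Qed.

Lemma smooth_at_near (W : normedModType R) p (f : M -> W) : smooth_at p f ->
  \forall q \near p, smooth_at q f.
Proof.
move=> [i [N [oN Np Ni fs]]].
have : \forall q \near p, N q by exact: open_nbhs_nbhs.
by apply: filterS => q Nq; exists i, N.
Qed.

Lemma smooth_at_eq (W : normedModType R) p (f f' : M -> W) :
  (\forall q \near p, f q = f' q) -> smooth_at p f -> smooth_at p f'.
Proof.
move=> /near_openE[B [oB Bp BP]] [i [N [oN Np Ni fs]]].
have sNB : N `&` B `<=` dom i by move=> q [/Ni].
have oNB : open (N `&` B) by exact: openI.
exists i, (N `&` B); split => // k.
apply: (@Ck_eq _ _ _ _ _ (f \o param i)); first exact: open_chart_image.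
  by move=> _ [q [/Ni iq Bq] <-] /=; rewrite coordK // BP.
by apply: Ck_sub (fs k) => _ [q [Nq Bq] <-]; exists q.
Qed.

Lemma smooth_on_at (W : normedModType R) i p (f : M -> W) :
  smooth_on (cdom i) (f \o param i) -> dom i p -> smooth_at p f.
Proof. by move=> fs ip; exists i, (dom i); split => //; exact: dom_open. Qed.

Lemma smooth_at_on (W : normedModType R) {fW : fin_dim W} i (f : M -> W) :
  (forall p, dom i p -> smooth_at p f) -> smooth_on (cdom i) (f \o param i).
Proof.
move=> fs k; apply: Ck_local => _ [p ip <-].
have [N [oN Np Ni fN]] := smooth_atP (fs p ip) ip.
by exists (coord i @` N); split; [exact: open_chart_image|exists p|exact: fN].
Qed.

Lemma smooth_at_cst (W : normedModType R) p (w : W) : smooth_at p (fun=> w).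
Proof.
apply: (smooth_on_at (i := chart_at p)); last exact: chart_at_dom.
by move=> k; exact: Ck_cst.
Qed.

Lemma smooth_at_coord i p : dom i p -> smooth_at p (coord i).
Proof.
move=> ip; exists i, (dom i); split => //; first exact: dom_open.
by move=> k; have := @transition_smooth i i k; rewrite setIid.
Qed.

Lemma smooth_at_pair (V W : normedModType R) {fV : fin_dim V} {fW : fin_dim W}
    p (f : M -> V) (f' : M -> W) :
  smooth_at p f -> smooth_at p f' -> smooth_at p (fun q => (f q, f' q)).
Proof.
move=> /(smooth_atP (j := chart_at p))/(_ (chart_at_dom p))[N [oN Np Ni fs]].
move=> /(smooth_atP (j := chart_at p))/(_ (chart_at_dom p))[N' [oN' Np' Ni' fs']].
have s : N `&` N' `<=` dom (chart_at p) by move=> q [/Ni].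
have o : open (N `&` N') by exact: openI.
exists (chart_at p), (N `&` N'); split => // k.
apply: Ck_pair; first exact: open_chart_image.
  by apply: Ck_sub (fs k) => _ [q [Nq Nq'] <-]; exists q.
by apply: Ck_sub (fs' k) => _ [q [Nq Nq'] <-]; exists q.
Qed.

(** [F] is controlled on [O] alone, so the neighbourhood of [p] is shrunk, by continuity of [G] in
    the chart, until [G] maps it into [O]. *)
Lemma smooth_at_comp (V W : normedModType R) {fV : fin_dim V} {fW : fin_dim W}
    p (O : set V) (F : V -> W) (G : M -> V) : open O -> O (G p) ->
  smooth_on O F -> smooth_at p G -> smooth_at p (F \o G).
Proof.
move=> oO Op Fs [i [N [oN Np Ni fs]]].
have oB : open (coord i @` N) by exact: open_chart_image.
have cG : continuous_at (coord i p) (G \o param i).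
  by apply: (Ck_continuous (fs 0%N)); exists p.
have nO : \forall q \near p, O (G q).
  have : \forall x \near coord i p, O (G (param i x)).
    by apply: cG; rewrite /= coordK; [exact: open_nbhs_nbhs|exact: Ni].
  move=> /(coord_continuous_at (Ni _ Np)) H.
  near=> q; rewrite -(coordK (i := i) (p := q)); last first.
    by apply: Ni; near: q; exact: open_nbhs_nbhs.
  by near: q.
have [N' [oN' Np' NO]] := near_openE nO.
have s : N `&` N' `<=` dom i by move=> q [/Ni].
have o : open (N `&` N') by exact: openI.
exists i, (N `&` N'); split => // k.
have H : Ck k (coord i @` (N `&` N')) (G \o param i).
  by apply: Ck_sub (fs k) => _ [q [Nq Nq'] <-]; exists q.
apply: (Ck_comp (open_chart_image o s) oO _ (Fs k) H).
by move=> _ [q [Nq Nq'] <-] /=; rewrite coordK; [exact: NO|exact: Ni].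
Unshelve. all: by end_near. Qed.

End charts.

Lemma Ck_id (R : realType) (V : normedModType R) k (U : set V) : open U ->
  Ck k U (id : V -> V).
Proof. by move=> oU; apply: (@Ck_linear _ _ _ _ _ idfun) => // x; exact: cvg_id. Qed.

(** * Calculus of germs and of partial derivatives in charts *)

Section partial_calculus.
Context {R : realType} {n : nat} (M : manifold R n).
Implicit Types (i j : atlas M) (p q : M) (f u : M -> R^o).

Lemma smooth_at_linear (W W' : normedModType R) {fW : fin_dim W} {fW' : fin_dim W'}
    (l : {linear W -> W'}) p (f : M -> W) : continuous l ->
  smooth_at p f -> smooth_at p (l \o f).
Proof.
move=> cl fs; apply: (smooth_at_comp (O := setT) openT _ _ fs) => // k.
exact: Ck_linear openT cl.
Qed.

Lemma smooth_atD (W : normedModType R) {fW : fin_dim W} p (f f' : M -> W) :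
  smooth_at p f -> smooth_at p f' -> smooth_at p (fun q => f q + f' q).
Proof.
move=> fs fs'; apply: (smooth_at_comp (F := fun z : W * W => z.1 + z.2)
  openT _ _ (smooth_at_pair fs fs')) => // k.
by apply: CkD; [exact: openT|apply: Ck_fst|apply: Ck_snd];
  (try exact: Ck_id openT); exact: openT.
Qed.

Lemma smooth_atM p f u :
  smooth_at p f -> smooth_at p u -> smooth_at p (fun q => f q * u q : R^o).
Proof.
move=> fs fs'; apply: (smooth_at_comp (F := fun z : R^o * R^o => z.1 * z.2 : R^o)
  openT _ _ (smooth_at_pair fs fs')) => // k.
by apply: CkM; [exact: openT|apply: Ck_fst|apply: Ck_snd];
  (try exact: Ck_id openT); exact: openT.
Qed.

Lemma smooth_atN p f : smooth_at p f -> smooth_at p (fun q => - f q : R^o).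
Proof.
move=> fs; have := smooth_atM (smooth_at_cst p (-1 : R^o)) fs.
by apply: smooth_at_eq; apply: nearW => q; rewrite mulN1r.
Qed.

Lemma smooth_atB p f u :
  smooth_at p f -> smooth_at p u -> smooth_at p (fun q => f q - u q : R^o).
Proof. by move=> fs us; apply: smooth_atD => //; exact: smooth_atN. Qed.

Lemma smooth_at_sum (W : normedModType R) {fW : fin_dim W} (I : Type) (r : seq I)
    (P : pred I) p (f : I -> M -> W) :
  (forall k, P k -> smooth_at p (f k)) ->
  smooth_at p (fun q => \sum_(k <- r | P k) f k q).
Proof.
move=> fs; elim: r => [|k r IH].
  have := smooth_at_cst p (0 : W).
  by apply: smooth_at_eq; apply: nearW => q; rewrite big_nil.
have : smooth_at p (fun q => (if P k then f k q else 0) + \sum_(k <- r | P k) f k q).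
  by apply: smooth_atD => //; case: (P k) (fs k) => [|_]; [exact|exact: smooth_at_cst].
apply: smooth_at_eq; apply: nearW => q; rewrite big_cons.
by case: (P k) => //; rewrite add0r.
Qed.

Lemma smooth_at_entry (m1 m2 : nat) (a : 'I_m1) (b : 'I_m2) p (f : M -> 'M[R]_(m1, m2)) :
  smooth_at p f -> smooth_at p (fun q => f q a b : R^o).
Proof.
move=> fs; apply: (smooth_at_linear (l := mx_coord (a, b)) _ fs) => x.
exact: coord_continuous.
Qed.

Lemma smooth_at_mx (m1 m2 : nat) p (f : M -> 'M[R]_(m1, m2)) :
  (forall a b, smooth_at p (fun q => f q a b : R^o)) -> smooth_at p f.
Proof.
move=> fs.
have : smooth_at p (fun q => \sum_a \sum_b f q a b *: delta_mx a b : 'M[R]_(m1, m2)).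
  apply: smooth_at_sum => a _; apply: smooth_at_sum => b _.
  pose l (r : R^o) : 'M[R]_(m1, m2) := r *: delta_mx a b.
  have linl : linear l by move=> c u v; rewrite /l scalerDl scalerA.
  pose L : {linear _ -> _} := HB.pack l (GRing.isLinear.Build _ _ _ _ _ linl).
  by apply: (smooth_at_linear (l := L) _ (fs a b)); exact: scalel_continuous.
by apply: smooth_at_eq; apply: nearW => q; rewrite -matrix_sum_delta.
Qed.

Lemma smooth_at_differentiable (W : normedModType R) {fW : fin_dim W} i p (f : M -> W) :
  smooth_at p f -> dom i p -> differentiable (f \o param i) (coord i p).
Proof.
move=> fs ip; have [N [oN Np Ni fN]] := smooth_atP fs ip.
by apply: (C1_differentiable (open_chart_image oN Ni) (fN 1%N)); exists p.
Qed.

Lemma smooth_at_derivable (W : normedModType R) {fW : fin_dim W} i p (f : M -> W) v :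
  smooth_at p f -> dom i p -> derivable (f \o param i) (coord i p) v.
Proof. by move=> fs ip; apply: diff_derivable; exact: smooth_at_differentiable. Qed.

Lemma partial_near i a p (f f' : M -> R) : dom i p ->
  (\forall q \near p, f q = f' q) -> partial i a f p = partial i a f' p.
Proof.
move=> ip ff'; rewrite /partial; apply: near_eq_derive.
exact: (near_param ip ff').
Qed.

Lemma smooth_at_partial i a p f : smooth_at p f -> dom i p ->
  smooth_at p (partial i a f : M -> R^o).
Proof.
move=> fs ip; have [N [oN Np Ni fN]] := smooth_atP fs ip.
exists i, N; split => // k.
apply: (@Ck_eq _ _ _ _ _ ('D_(delta_mx 0 a) (f \o param i))).
- exact: open_chart_image.
- by move=> _ [q /Ni iq <-]; rewrite /= /partial coordK.
- exact: ((fN k.+1).2 _).2.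
Qed.

Lemma partial_cst i a p (c : R) : partial i a (fun=> c) p = 0.
Proof. exact: derive_cst. Qed.

Lemma partialD i a p f u : smooth_at p f -> smooth_at p u -> dom i p ->
  partial i a (fun q => f q + u q) p = partial i a f p + partial i a u p.
Proof.
move=> fs us ip; rewrite /partial -[RHS]deriveD //; exact: smooth_at_derivable.
Qed.

Lemma partialM i a p f u : smooth_at p f -> smooth_at p u -> dom i p ->
  partial i a (fun q => f q * u q) p =
  f p * partial i a u p + u p * partial i a f p.
Proof.
move=> fs us ip; rewrite /partial.
have := @deriveM _ _ (f \o param i) (u \o param i) (coord i p) (delta_mx 0 a)
  (smooth_at_derivable fs ip) (smooth_at_derivable us ip).
rewrite /= (coordK ip) => H; exact: H.
Qed.

Lemma partialZ i a p (c : R) f : smooth_at p f -> dom i p ->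
  partial i a (fun q => c * f q) p = c * partial i a f p.
Proof.
move=> fs ip; rewrite (partialM _ (smooth_at_cst p (c : R^o)) fs) //.
by rewrite partial_cst mulr0 addr0.
Qed.

Lemma partialB i a p f u : smooth_at p f -> smooth_at p u -> dom i p ->
  partial i a (fun q => f q - u q) p = partial i a f p - partial i a u p.
Proof.
move=> fs us ip; rewrite partialD //; last exact: smooth_atN.
congr (_ + _); rewrite -mulN1r -partialZ //; apply: partial_near => //.
by apply: nearW => q; rewrite mulN1r.
Qed.

Lemma partial_sum i a p (I : Type) (r : seq I) (f : I -> M -> R^o) :
  (forall k, smooth_at p (f k)) -> dom i p ->
  partial i a (fun q => \sum_(k <- r) f k q) p = \sum_(k <- r) partial i a (f k) p.
Proof.
move=> fs ip; elim: r => [|k r IH].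
  rewrite big_nil -[RHS](partial_cst i a p 0); apply: partial_near => //.
  by apply: nearW => q; rewrite big_nil.
rewrite big_cons -IH -partialD //; last exact: smooth_at_sum.
by apply: partial_near => //; apply: nearW => q; rewrite big_cons.
Qed.

Lemma partial_comp (V : normedModType R) {fV : fin_dim V} i a p (F : V -> R^o)
    (G : M -> V) : smooth_at p G -> differentiable F (G p) -> dom i p ->
  partial i a (F \o G) p =
  'D_('D_(delta_mx 0 a) (G \o param i) (coord i p)) F (G p).
Proof.
move=> Gs dF ip; rewrite /partial.
have dF' : differentiable F ((G \o param i) (coord i p)) by rewrite /= coordK.
have [_] := is_derive_comp (smooth_at_derivable (v := delta_mx 0 a) Gs ip) dF'.
by rewrite /= (coordK ip).
Qed.

Lemma derive_row (m : nat) (F : 'rV[R]_m -> R^o) x (w : 'rV[R]_m) :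
  differentiable F x -> 'D_w F x = \sum_a w 0 a * 'D_(delta_mx 0 a) F x.
Proof.
move=> dF; rewrite deriveE // {1}(row_sum_delta w) linear_sum.
by apply: eq_bigr => a _; rewrite linearZ deriveE.
Qed.

Lemma partial_chain i j b p f : smooth_at p f -> dom i p -> dom j p ->
  partial j b f p = \sum_a jac i j p b a * partial i a f p.
Proof.
move=> fs ip jp.
(* Reading [f] through the chart [i] is legitimate only on [dom i], hence an equality near [p]
   rather than everywhere. *)
rewrite (@partial_near j b p f ((f \o param i) \o coord i)) //; last first.
  by apply: filterS (near_dom ip) => q iq /=; rewrite coordK.
have df : differentiable (f \o param i) (coord i p) by exact: smooth_at_differentiable.
have cs := smooth_at_coord ip.
rewrite (partial_comp _ cs df jp) derive_row //; apply: eq_bigr => a _.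
congr (_ * _); rewrite derive_mx ?mxE //.
exact: smooth_at_derivable.
Qed.

Lemma partial_comm i a b p f : smooth_at p f -> dom i p ->
  partial i a (partial i b f) p = partial i b (partial i a f) p.
Proof.
move=> fs ip; have [N [oN Np Ni fN]] := smooth_atP fs ip.
have oB := open_chart_image oN Ni.
have E c d : partial i c (partial i d f) p =
    'D_(delta_mx 0 c) ('D_(delta_mx 0 d) (f \o param i)) (coord i p).
  rewrite {1}/partial; apply: near_eq_derive.
  apply: (open_near oB); first by exists p.
  by move=> _ [q /Ni iq <-]; rewrite /= /partial coordK.
by rewrite !E; apply: (derive_comm _ _ oB (fN 2%N)); exists p.
Qed.

Lemma partial_coord i a b p : dom i p ->
  partial i a (fun q => coord i q 0 b) p = (a == b)%:R.
Proof.
move=> ip; rewrite /partial.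
rewrite (@near_eq_derive _ _ _ _ (mx_coord (0, b) : 'rV[R]_n -> R^o)).
  rewrite deriveE; last exact: differentiable_coord.
  rewrite diff_lin; last exact: coord_continuous.
  by rewrite -[LHS]/((delta_mx 0 a : 'rV[R]_n) 0 b) mxE eqxx eq_sym.
apply: (open_near (@cdom_open _ _ M i)); first by exists p.
by move=> x ix /=; rewrite paramK.
Qed.

End partial_calculus.

(** * Tensors in charts *)

Section tensors.
Context {R : realType} {n : nat} {M : manifold R n}.
Implicit Types (i j k : atlas M) (p q : M) (f u : M -> R^o).

(** The chain rule for the coordinates of the chart [i]. This cocycle law is behind every change of
    chart. *)
Lemma jac_comp i j k p : dom i p -> dom j p -> dom k p ->
  jac j k p *m jac i j p = jac i k p.
Proof.
move=> ip jp kp; apply/matrixP => b a; rewrite !mxE.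
have s : smooth_at p (fun q => coord i q 0 a : R^o).
  by apply: smooth_at_entry; exact: smooth_at_coord.
rewrite (partial_chain b s jp kp); apply: eq_bigr => c _; rewrite !mxE //.
Qed.

Lemma jac_id i p : dom i p -> jac i i p = 1%:M.
Proof. by move=> ip; apply/matrixP => b a; rewrite !mxE partial_coord. Qed.

Lemma jacK i j p : dom i p -> dom j p -> jac i j p *m jac j i p = 1%:M.
Proof. by move=> ip jp; rewrite jac_comp // jac_id. Qed.

Lemma jac_unitmx i j p : dom i p -> dom j p -> jac i j p \in unitmx.
Proof. by move=> ip jp; have /mulmx1_unit[] := jacK ip jp. Qed.

Lemma transition_T1_comp i j k p w : dom i p -> dom j p -> dom k p ->
  transition_T1 M j k p (transition_T1 M i j p w) = transition_T1 M i k p w.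
Proof. by move=> ip jp kp; rewrite /transition_T1 mulmxA jac_comp. Qed.

Lemma transition_T1_id i p w : dom i p -> transition_T1 M i i p w = w.
Proof. by move=> ip; rewrite /transition_T1 jac_id // mul1mx. Qed.

Lemma transition_T2_comp i j k p T : dom i p -> dom j p -> dom k p ->
  transition_T2 M j k p (transition_T2 M i j p T) = transition_T2 M i k p T.
Proof.
move=> ip jp kp; rewrite /transition_T2 -(jac_comp ip jp kp) trmx_mul.
by rewrite !mulmxA.
Qed.

Lemma transition_T2_id i p T : dom i p -> transition_T2 M i i p T = T.
Proof. by move=> ip; rewrite /transition_T2 jac_id // trmx1 mul1mx mulmx1. Qed.

Definition grad i f p : 'cV[R]_n := \col_a partial i a f p.

Lemma grad_chain i j p f : smooth_at p f -> dom i p -> dom j p ->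
  grad j f p = transition_T1 M i j p (grad i f p).
Proof.
move=> fs ip jp; apply/colP => b; rewrite !mxE (partial_chain b fs ip jp).
by apply: eq_bigr => a _; rewrite !mxE.
Qed.

Lemma components_exterior_d i p f : smooth_at p f -> dom i p ->
  components (transition_T1 M) i (exterior_d f) p = grad i f p.
Proof. by move=> fs ip; rewrite (grad_chain fs (chart_at_dom p) ip). Qed.

Lemma smooth_at_grad i p f : smooth_at p f -> dom i p -> smooth_at p (grad i f).
Proof.
move=> fs ip; apply: smooth_at_mx => a b.
have := smooth_at_partial a fs ip.
by apply: smooth_at_eq; apply: nearW => q; rewrite mxE.
Qed.

Context (Gamma : coefficients M).

(** The components of the Hessian in an arbitrary chart. [hessian] uses the preferred chart, which
    changes with the point; in a fixed chart the components can be differentiated and compared. *)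
Definition hess i f p : 'M[R]_n := \matrix_(a, b)
  (partial i a (partial i b f) p - \sum_c Gamma i p c a b * partial i c f p).

Lemma hessianE p f : smooth_at p f ->
  hessian Gamma f p = hess (chart_at p) f p.
Proof.
move=> fs; have ip := chart_at_dom p.
apply/matrixP => a b; rewrite !mxE; congr (_ - _).
  apply: partial_near => //; near=> q.
  rewrite components_exterior_d ?mxE //; near: q; first exact: smooth_at_near.
  exact: near_dom.
by apply: eq_bigr => c _; rewrite components_exterior_d // mxE.
Unshelve. all: by end_near. Qed.

Context (GammaL : linear_connection Gamma).

Lemma smooth_at_Gamma i p c a b : dom i p ->
  smooth_at p (fun q => Gamma i q c a b : R^o).
Proof. exact: smooth_on_at (GammaL.1 i c a b). Qed.

Lemma smooth_at_hess i p f : smooth_at p f -> dom i p -> smooth_at p (hess i f).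
Proof.
move=> fs ip; apply: smooth_at_mx => a b.
have : smooth_at p (fun q => partial i a (partial i b f) q -
    \sum_c Gamma i q c a b * partial i c f q : R^o).
  apply: smooth_atB.
    by apply: smooth_at_partial => //; exact: smooth_at_partial.
  apply: smooth_at_sum => c _; apply: smooth_atM; first exact: smooth_at_Gamma.
  exact: smooth_at_partial.
by apply: smooth_at_eq; apply: nearW => q; rewrite mxE.
Qed.

Lemma smooth_at_jac i j p b a : dom i p -> dom j p ->
  smooth_at p (fun q => jac i j q b a : R^o).
Proof.
move=> ip jp.
have s : smooth_at p (fun q => coord i q 0 a : R^o).
  by apply: smooth_at_entry; exact: smooth_at_coord.
have := smooth_at_partial b s jp.
by apply: smooth_at_eq; apply: nearW => q; rewrite mxE.
Qed.

(** Differentiating the chain rule produces second derivatives of the transition functions; the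
    inhomogeneous term in the transformation law of [Gamma] cancels exactly these. *)
Lemma hess_tensor i j p f : smooth_at p f -> dom i p -> dom j p ->
  hess j f p = transition_T2 M i j p (hess i f p).
Proof.
move=> fs ip jp; apply/matrixP => a b; rewrite mxE.
have sx c : smooth_at p (fun q => coord i q 0 c : R^o).
  by apply: smooth_at_entry; exact: smooth_at_coord.
have sJ c : smooth_at p (partial j b (fun q => coord i q 0 c) : M -> R^o).
  exact: smooth_at_partial.
have sd c := smooth_at_partial c fs ip.
have E1 : partial j a (partial j b f) p =
    \sum_c (jac i j p b c * \sum_l jac i j p a l * partial i l (partial i c f) p +
       partial i c f p * partial j a (partial j b (fun q => coord i q 0 c)) p).
  rewrite (@partial_near _ _ _ j a p _ (fun q => \sum_c
      (partial j b (fun q => coord i q 0 c) q * partial i c f q))) //; last first.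
    near=> q.
    rewrite (@partial_chain _ _ _ i j b q f); last 3 first.
    + by near: q; exact: smooth_at_near.
    + by near: q; exact: near_dom.
    + by near: q; exact: near_dom.
    by apply: eq_bigr => c _; rewrite mxE.
  rewrite partial_sum //; last by move=> c; exact: smooth_atM.
  apply: eq_bigr => c _; rewrite partialM // mxE; congr (_ * _ + _).
  exact: partial_chain.
rewrite E1 big_split /= -addrA.
have -> : \sum_c Gamma j p c a b * partial j c f p =
    \sum_c partial i c f p * (\sum_l \sum_m Gamma i p c l m * jac i j p a l * jac i j p b m +
     partial j a (partial j b (fun q => coord i q 0 c)) p).
  under eq_bigr => c _ do rewrite (partial_chain c fs ip jp) mulr_sumr.
  rewrite exchange_big /=; apply: eq_bigr => k _.
  rewrite -(GammaL.2 i j p ip jp k a b) mulr_sumr; apply: eq_bigr => c _.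
  by rewrite mulrA mulrC.
under [in X in _ + (_ - X)]eq_bigr => c _ do rewrite mulrDr.
rewrite big_split /=.
have cancel3 (x y z : R) : x + (y - (z + y)) = x - z by ring.
rewrite cancel3.
have -> : \sum_c jac i j p b c * (\sum_l jac i j p a l * partial i l (partial i c f) p) =
    \sum_m \sum_l jac i j p a l * partial i l (partial i m f) p * jac i j p b m.
  by apply: eq_bigr => m _; rewrite mulrC mulr_suml.
have -> : \sum_k partial i k f p *
      (\sum_l \sum_m Gamma i p k l m * jac i j p a l * jac i j p b m) =
    \sum_m \sum_l jac i j p a l * (\sum_k Gamma i p k l m * partial i k f p) *
      jac i j p b m.
  under eq_bigr => k _.
    rewrite mulr_sumr; under eq_bigr => l _ do rewrite mulr_sumr.
    rewrite exchange_big; over.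
  rewrite exchange_big; apply: eq_bigr => m _ /=.
  rewrite exchange_big; apply: eq_bigr => l _ /=.
  by rewrite mulr_sumr mulr_suml; apply: eq_bigr => k _; ring.
rewrite -sumrB /transition_T2 !mxE; apply: eq_bigr => m _.
rewrite -sumrB !mxE mulr_suml; apply: eq_bigr => l _.
by rewrite !mxE; ring.
Unshelve. all: by end_near. Qed.

Context (g : M -> 'M[R]_n) (gR : riemannian_metric g).

Notation gi := (components (transition_T2 M)).

Lemma metric_tensor i j p : dom i p -> dom j p ->
  gi j g p = transition_T2 M i j p (gi i g p).
Proof. by move=> ip jp; rewrite [RHS]transition_T2_comp //; exact: chart_at_dom. Qed.

(** A nonzero vector in the kernel would contradict positivity. *)
Lemma metric_unitmx p : g p \in unitmx.
Proof.
rewrite -row_free_unit -kermx_eq0; apply/rowV0P => v /sub_kermxP vg.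
apply/eqP; apply: contraT => v0; have [_ _ /(_ p v v0)] := gR.
by rewrite vg mul0mx mxE ltxx.
Qed.

Lemma components_metric_unitmx i p : dom i p -> gi i g p \in unitmx.
Proof.
move=> ip; rewrite /gi /transition_T2 !unitmx_mul metric_unitmx unitmx_tr.
by rewrite jac_unitmx //; exact: chart_at_dom.
Qed.

Lemma components_metric_sym i p : (gi i g p)^T = gi i g p.
Proof.
have [_ gs _] := gR.
by rewrite /components /transition_T2 !trmx_mul trmxK gs mulmxA.
Qed.

(** The inverse metric has upper indices, hence the Jacobian in the opposite direction. *)
Lemma invmx_transition_T2 i j p (S : 'M[R]_n) : dom i p -> dom j p ->
  S \in unitmx ->
  invmx (transition_T2 M i j p S) = (jac j i p)^T *m invmx S *m jac j i p.
Proof.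
move=> ip jp uS.
have E : transition_T2 M i j p S *m ((jac j i p)^T *m invmx S *m jac j i p) = 1%:M.
  rewrite /transition_T2 -!mulmxA (mulmxA _^T) -trmx_mul jacK // trmx1 mul1mx.
  by rewrite (mulmxA S) mulmxV // mul1mx jacK.
have [uT _] := mulmx1_unit E.
by rewrite -[RHS]mul1mx -(mulVmx uT) -(mulmxA (invmx _)) E mulmx1.
Qed.

Lemma trace_transition_T2 i j p (S T : 'M[R]_n) : dom i p -> dom j p ->
  S \in unitmx ->
  \tr (invmx (transition_T2 M i j p S) *m transition_T2 M i j p T) =
  \tr (invmx S *m T).
Proof.
move=> ip jp uS; rewrite invmx_transition_T2 // /transition_T2 !mulmxA.
rewrite -(mulmxA _ (jac j i p)) jacK // mulmx1 mxtrace_mulC !mulmxA.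
by rewrite -trmx_mul jacK // trmx1 mul1mx.
Qed.

End tensors.

#[global] Instance fin_dim_fiber_V (R : realType) n : fin_dim (fiber_V R n) :=
  @fin_dim_pair R (R^o * 'cV[R]_n)%type R^o _ _.
#[global] Instance fin_dim_fiber_J1 (R : realType) n : fin_dim (fiber_J1 R n) :=
  @fin_dim_pair R R^o 'cV[R]_n _ _.
#[global] Instance fin_dim_fiber_TV (R : realType) n : fin_dim (fiber_TV R n) :=
  @fin_dim_pair R ('cV[R]_n * 'M[R]_n)%type 'cV[R]_n _ _.

Lemma open_fst (R : realType) (V W : normedModType R) (U : set V) :
  open U -> open [set z : V * W | U z.1].
Proof.
move=> oU; apply: (@open_comp _ _ (@fst V W)) => // z _; exact: cvg_fst.
Qed.

Lemma derive_pair (R : realType) (X V W : normedModType R) (f : X -> V) (h : X -> W) x v :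
  differentiable f x -> differentiable h x ->
  'D_v (fun y => (f y, h y)) x = ('D_v f x, 'D_v h x).
Proof.
move=> df dh; rewrite !deriveE //; first by rewrite diff_pair.
exact: differentiable_pair.
Qed.

(** * The integrability condition *)

Section jets.
Context {R : realType} {n : nat} {M : manifold R n}.
Implicit Types (i j : atlas M) (p q : M) (f u H : M -> R^o).
Context (g : M -> 'M[R]_n) (gR : riemannian_metric g).
Context (Gamma : coefficients M) (GammaL : linear_connection Gamma).
Context (A : M -> fiber_J1 R n -> 'M[R]_n).
Context (AB : bundle_map (transition_J1 M) (transition_T2 M) A).

Notation gi := (components (transition_T2 M)).
Notation Ai := (bundle_map_in_chart (transition_J1 M) (transition_T2 M) A).

Lemma bundle_map_chartE i q (v : fiber_J1 R n) : dom i q ->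
  Ai i (coord i q, v) = transition_T2 M (chart_at q) i q
    (A q (v.1, transition_T1 M i (chart_at q) q v.2)).
Proof. by move=> iq; rewrite /bundle_map_in_chart /= coordK. Qed.

Lemma bundle_map_tensor i j q (y : R^o) (phi : 'cV[R]_n) : dom i q -> dom j q ->
  Ai j (coord j q, (y, transition_T1 M i j q phi)) =
  transition_T2 M i j q (Ai i (coord i q, (y, phi))).
Proof.
move=> iq jq; have cq := chart_at_dom q.
rewrite (bundle_map_chartE _ iq) (bundle_map_chartE _ jq).
by rewrite (transition_T1_comp _ iq jq cq) (transition_T2_comp _ cq iq jq).
Qed.

(* The point [z] is [(x, (h, phi, f))] in the chart [i].  [jet2] is the matrix P of
   second partial derivatives forced on a solution, [jet3 a b c] is Q_abc. *)
Definition jet2 i (z : 'rV[R]_n * fiber_V R n) : 'M[R]_n :=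
  \matrix_(b, c) (\sum_e Gamma i (param i z.1) e b c * z.2.1.2 e 0)
  - z.2.1.1 *: gi i g (param i z.1) - Ai i (z.1, (z.2.2, z.2.1.2)).

(** The velocity along e_a of the jet of a solution, with 0 in the slot of h. The true entry d_a h
    is the unknown; as [jet2] is affine in h, its contribution is the separate term -d_a h g_bc. *)
Definition jet2_dir i a (z : 'rV[R]_n * fiber_V R n) : 'rV[R]_n * fiber_V R n :=
  (delta_mx 0 a, (0, \col_d jet2 i z a d, z.2.1.2 a 0)).

Definition jet3 i a b c (z : 'rV[R]_n * fiber_V R n) : R^o :=
  'D_(jet2_dir i a z) (fun y => jet2 i y b c : R^o) z.

Definition tau i (z : 'rV[R]_n * fiber_V R n) : 'cV[R]_n :=
  \col_a ((n%:R - 1)^-1 * \sum_b \sum_c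
    invmx (gi i g (param i z.1)) b c * (jet3 i a b c z - jet3 i b a c z)).

Definition zdom i : set ('rV[R]_n * fiber_V R n) := [set z | cdom i z.1].

Lemma open_zdom i : open (zdom i).
Proof. by apply: open_fst; exact: cdom_open. Qed.

Lemma Ck_zdom (W : normedModType R) {fW : fin_dim W} i k (F : 'rV[R]_n -> W) :
  Ck k (cdom i) F -> Ck k (zdom i) (fun z => F z.1).
Proof.
move=> cF; pose G (z : 'rV[R]_n * fiber_V R n) : 'rV[R]_n := z.1.
have GU z : zdom i z -> cdom i (G z) by [].
apply: (@Ck_comp _ _ _ _ _ _ _ _ _ _ G (@open_zdom i) (@cdom_open _ _ M i) GU cF).
by apply: Ck_fst; [exact: open_zdom|exact: Ck_id (@open_zdom i)].
Qed.

Lemma Ck_jet2 i k : Ck k (zdom i) (jet2 i).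
Proof.
have oz := @open_zdom i; have cid := @Ck_id R _ k _ oz.
have c2 := Ck_snd oz cid; have c1 := Ck_fst oz cid.
have c22 := Ck_snd oz c2; have c21 := Ck_fst oz c2.
have c212 := Ck_snd oz c21; have c211 := Ck_fst oz c21.
have cG : Ck k (zdom i) (fun z => \matrix_(b, c)
    (\sum_e Gamma i (param i z.1) e b c * z.2.1.2 e 0) : 'M[R]_n).
  apply: Ck_mx => // b c.
  apply: (@Ck_eq _ _ _ _ _ (fun z : 'rV[R]_n * fiber_V R n =>
     \sum_e Gamma i (param i z.1) e b c * z.2.1.2 e 0 : R^o)) => //.
    by move=> z _; rewrite mxE.
  apply: Ck_sum => // e _; apply: CkM => //; last exact: Ck_entry c212.
  exact: (Ck_zdom (F := (fun q => Gamma i q e b c : R^o) \o param i) (GammaL.1 i e b c k)).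
have [gs _ _] := gR.
have cg : Ck k (zdom i) (fun z => z.2.1.1 *: gi i g (param i z.1)).
  apply: Ck_mx => // b c.
  apply: (@Ck_eq _ _ _ _ _ (fun z : 'rV[R]_n * fiber_V R n =>
     z.2.1.1 * gi i g (param i z.1) b c : R^o)) => //.
    by move=> z _; rewrite [RHS]mxE.
  apply: CkM => //; apply: Ck_entry => //.
  exact: (Ck_zdom (gs i k)).
have cA : Ck k (zdom i) (fun z => Ai i (z.1, (z.2.2, z.2.1.2))).
  apply: (@Ck_comp _ _ _ _ _ _ _ _ _ (Ai i) (fun z : 'rV[R]_n * fiber_V R n =>
    (z.1, (z.2.2, z.2.1.2) : fiber_J1 R n)) oz _ _ (AB i k)) => //.
    by apply: open_fst; exact: cdom_open.
  by apply: Ck_pair => //; exact: Ck_pair.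
have cNN (f1 f2 : 'rV[R]_n * fiber_V R n -> 'M[R]_n) :
    Ck k (zdom i) f1 -> Ck k (zdom i) f2 -> Ck k (zdom i) (fun z => f1 z - f2 z).
  move=> cf1 cf2; apply: Ck_mx => // b c.
  apply: (@Ck_eq _ _ _ _ _ (fun z => f1 z b c + -1 * f2 z b c : R^o)) => //.
    by move=> z _; rewrite !mxE mulN1r.
  apply: CkD => //; first exact: Ck_entry.
  by apply: CkM => //; [exact: Ck_cst|exact: Ck_entry].
exact: (cNN _ _ (cNN _ _ cG cg) cA).
Qed.

Lemma Ck_jet3 i a b c k : Ck k (zdom i) (jet3 i a b c).
Proof.
have oz := @open_zdom i; have cid := @Ck_id R _ k _ oz.
apply: (@Ck_derive_along _ _ _ _ _ _ (zdom i) (fun y => jet2 i y b c : R^o) id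
  (jet2_dir i a)) => //.
  exact: Ck_entry (Ck_jet2 i k.+1).
have c2 := Ck_snd oz cid; have c21 := Ck_fst oz c2; have c212 := Ck_snd oz c21.
apply: Ck_pair => //; first exact: Ck_cst.
apply: Ck_pair => //; last exact: Ck_entry c212.
apply: Ck_pair => //; first exact: Ck_cst.
apply: Ck_mx => // d e.
apply: (@Ck_eq _ _ _ _ _ (fun z => jet2 i z a d : R^o)) => //.
  by move=> z _; rewrite mxE.
exact: Ck_entry (Ck_jet2 i k).
Qed.

Lemma smooth_tau i : smooth_on (zdom i) (tau i).
Proof.
move=> k; have oz := @open_zdom i.
have [gs _ _] := gR.
apply: Ck_mx => // a z0.
apply: (@Ck_eq _ _ _ _ _ (fun z => (n%:R - 1)^-1 * \sum_b \sum_c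
    invmx (gi i g (param i z.1)) b c * (jet3 i a b c z - jet3 i b a c z) : R^o)) => //.
  by move=> z _; rewrite mxE.
apply: CkM => //; first exact: Ck_cst.
apply: Ck_sum => // b _; apply: Ck_sum => // c _; apply: CkM => //.
  apply: Ck_entry => //.
  apply: (@Ck_zdom _ _ _ _ (fun x => invmx (gi i g (param i x)))).
  apply: Ck_invmx (gs i k); first exact: cdom_open.
  by move=> x ix; apply: (components_metric_unitmx gR); exact: param_dom.
apply: (@Ck_eq _ _ _ _ _ (fun z => jet3 i a b c z + -1 * jet3 i b a c z : R^o)) => //.
  by move=> z _; rewrite mulN1r.
apply: CkD => //; first exact: Ck_jet3.
by apply: CkM => //; [exact: Ck_cst|exact: Ck_jet3].
Qed.

End jets.

Lemma partial_comp_val (R : realType) (n : nat) (M : manifold R n)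
    (V : normedModType R) {fV : fin_dim V} (i : atlas M) a p (F : V -> R^o)
    (G : M -> V) w : smooth_at p G -> differentiable F (G p) -> dom i p ->
  'D_(delta_mx 0 a) (G \o param i) (coord i p) = w ->
  partial i a (fun q => F (G q)) p = 'D_w F (G p).
Proof. by move=> Gs dF ip <-; exact: partial_comp. Qed.

Lemma derive_along_addZ (R : realType) (V : normedModType R) (F : V -> R^o) z
    (v w : V) (c : R) : differentiable F z ->
  'D_(v + c *: w) F z = 'D_v F z + c * 'D_w F z.
Proof. by move=> dF; rewrite !deriveE // linearD linearZ. Qed.

(** * The tensor E along a pair of functions and its first derivatives *)

Section obstruction.
Context {R : realType} {n : nat} {M : manifold R n}.
Implicit Types (i j : atlas M) (p q : M) (f u H : M -> R^o).
Context (g : M -> 'M[R]_n) (gR : riemannian_metric g).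
Context (Gamma : coefficients M) (GammaL : linear_connection Gamma).
Context (A : M -> fiber_J1 R n -> 'M[R]_n).
Context (AB : bundle_map (transition_J1 M) (transition_T2 M) A).

Notation gi := (components (transition_T2 M)).
Notation Ai := (bundle_map_in_chart (transition_J1 M) (transition_T2 M) A).
Notation jet2 := (jet2 g Gamma A).
Notation jet2_dir := (jet2_dir g Gamma A).
Notation jet3 := (jet3 g Gamma A).
Notation tau := (tau g Gamma A).

Definition jet i u H q : 'rV[R]_n * fiber_V R n := (coord i q, (H q, grad i u q, u q)).

(** [H] is kept independent of [u]: for a solution it is minus the Laplacian divided by n, for chart
    independence it is constant. *)
Definition obstruction i u H q : 'M[R]_n :=
  hess Gamma i u q + H q *: gi i g q + Ai i (coord i q, (u q, grad i u q)).

Lemma obstructionE i u H q b c : dom i q ->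
  obstruction i u H q b c = partial i b (partial i c u) q - jet2 i (jet i u H q) b c.
Proof.
move=> iq; rewrite /obstruction /jet2 /jet /= coordK //.
move: (gi i g q) (Ai i _) => G B; rewrite !mxE.
have -> : \sum_e Gamma i q e b c * grad i u q e 0 =
    \sum_e Gamma i q e b c * partial i e u q.
  by apply: eq_bigr => e _; rewrite mxE.
by rewrite !opprB; ring.
Qed.

Lemma obstruction_tensor i j u H q : smooth_at q u -> dom i q -> dom j q ->
  obstruction j u H q = transition_T2 M i j q (obstruction i u H q).
Proof.
move=> us iq jq; rewrite /obstruction (hess_tensor GammaL us iq jq).
rewrite (metric_tensor _ iq jq) (grad_chain us iq jq) bundle_map_tensor //.
by rewrite /transition_T2 !mulmxDr !mulmxDl -scalemxAr -scalemxAl.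
Qed.

Lemma smooth_at_jet i u H p : smooth_at p u -> smooth_at p H -> dom i p ->
  smooth_at p (jet i u H).
Proof.
move=> us Hs ip; apply: smooth_at_pair; first exact: smooth_at_coord.
apply: smooth_at_pair => //; apply: smooth_at_pair => //.
exact: smooth_at_grad.
Qed.

Lemma smooth_at_jet2 i u H p b c : smooth_at p u -> smooth_at p H -> dom i p ->
  smooth_at p (fun q => jet2 i (jet i u H q) b c : R^o).
Proof.
move=> us Hs ip; have oz := @open_zdom _ _ _ i.
apply: (smooth_at_comp (F := fun z => jet2 i z b c : R^o) oz _ _ (smooth_at_jet us Hs ip)).
  by exists p.
by move=> k; apply: Ck_entry => //; exact: (Ck_jet2 gR GammaL AB).
Qed.

Lemma smooth_at_obstruction i u H p b c : smooth_at p u -> smooth_at p H -> dom i p ->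
  smooth_at p (fun q => obstruction i u H q b c : R^o).
Proof.
move=> us Hs ip.
have s : smooth_at p (fun q => partial i b (partial i c u) q
    - jet2 i (jet i u H q) b c : R^o).
  apply: smooth_atB; last exact: smooth_at_jet2.
  by apply: smooth_at_partial => //; exact: smooth_at_partial.
apply: smooth_at_eq s; apply: filterS (near_dom ip) => q iq.
by rewrite obstructionE.
Qed.

Lemma jet2_differentiable i b c z : zdom i z ->
  differentiable (fun y => jet2 i y b c : R^o) z.
Proof.
move=> iz; have oz := @open_zdom _ _ _ i.
apply: (C1_differentiable oz _ iz); apply: Ck_entry => //.
exact: (Ck_jet2 gR GammaL AB).
Qed.

(** [jet2] is affine in h, so the difference quotient is constant for nonzero [t]. *)
Lemma derive_jet2_top i b c (z : 'rV[R]_n * fiber_V R n) :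
  'D_((0, (1, 0, 0)) : 'rV[R]_n * fiber_V R n) (fun y => jet2 i y b c : R^o) z =
  - gi i g (param i z.1) b c.
Proof.
rewrite /derive; apply: lim_near_cst => //=; near=> t.
have t0 : t != 0 by near: t; exact: nbhs_dnbhs_neq.
case: z => x [[h phi] y]; rewrite /jet2 /= !scaler0 !add0r.
move: (gi i g _) (Ai i _) => G B; rewrite !mxE [t%:A]mulr1.
rewrite -[LHS]/(t^-1 * _) -[- G b c](mulKf t0); congr (_ * _).
by ring.
Unshelve. all: by end_near. Qed.

Lemma derive_jet i u H a p : smooth_at p u -> smooth_at p H -> dom i p ->
  'D_(delta_mx 0 a) (jet i u H \o param i) (coord i p) =
  (delta_mx 0 a, (partial i a H p, \col_d partial i a (partial i d u) p, partial i a u p)).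
Proof.
move=> us Hs ip.
have dc : differentiable (coord i \o param i) (coord i p).
  by apply: smooth_at_differentiable => //; exact: smooth_at_coord.
have du : differentiable (u \o param i) (coord i p) by exact: smooth_at_differentiable.
have dH : differentiable (H \o param i) (coord i p) by exact: smooth_at_differentiable.
have dg : differentiable (grad i u \o param i) (coord i p).
  by apply: smooth_at_differentiable => //; exact: smooth_at_grad.
have dHg := differentiable_pair dH dg.
have dV := differentiable_pair dHg du.
rewrite (derive_pair _ dc dV) (derive_pair _ dHg du) (derive_pair _ dH dg).
congr (_, (_, _, _)).
  rewrite (@near_eq_derive _ _ _ _ id) ?derive_id //.
  apply: (open_near (@cdom_open _ _ M i)); first by exists p.
  by move=> x ix /=; rewrite paramK.
rewrite derive_mx; last exact: diff_derivable.
apply/matrixP => d e; rewrite [LHS]mxE [RHS]mxE.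
have -> : (fun t => (grad i u \o param i) t d e) = partial i d u \o param i.
  by apply/funext => x; rewrite /= mxE.
by [].
Qed.

(** Where E vanishes, the second derivatives of [u] are the entries of [jet2]. The velocity of the
    jet is therefore [jet2_dir] plus d_a H times the direction of h, and [derive_jet2_top] evaluates
    the latter. *)
Lemma partial_obstruction i u H p a b c :
  smooth_at p u -> smooth_at p H -> dom i p -> obstruction i u H p = 0 ->
  partial i a (fun q => obstruction i u H q b c) p =
  partial i a (partial i b (partial i c u)) p + partial i a H p * gi i g p b c
  - jet3 i a b c (jet i u H p).
Proof.
move=> us Hs ip E0; pose z := jet i u H p.
have iz : zdom i z by exists p.
have dz := jet2_differentiable b c iz.
rewrite (@partial_near _ _ _ i a p _ (fun q => partial i b (partial i c u) q
    - jet2 i (jet i u H q) b c)) //; last first.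
  by apply: filterS (near_dom ip) => q iq; rewrite obstructionE.
have sd : smooth_at p (partial i b (partial i c u) : M -> R^o).
  by apply: smooth_at_partial => //; exact: smooth_at_partial.
have sj := smooth_at_jet2 b c us Hs ip.
rewrite (partialB a sd sj ip) -[RHS]addrA; congr (_ + _).
have Ej := @partial_comp_val _ _ _ _ (@fin_dim_pair R 'rV[R]_n (fiber_V R n) _ _)
  i a p (fun y => jet2 i y b c : R^o) (jet i u H) _ (smooth_at_jet us Hs ip) dz ip (derive_jet a us Hs ip).
rewrite Ej; clear Ej.
have -> : (delta_mx 0 a, (partial i a H p, \col_d partial i a (partial i d u) p,
     partial i a u p)) = jet2_dir i a z +
     partial i a H p *: ((0, (1, 0, 0)) : 'rV[R]_n * fiber_V R n).
  rewrite /jet2_dir; congr (_, (_, _, _)) => /=; rewrite ?scaler0 ?addr0 ?add0r //.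
  - by rewrite /= [RHS]mulr1.
  - apply/colP => d; rewrite [LHS]mxE [RHS]mxE; apply/eqP; rewrite -subr_eq0.
    by rewrite -(obstructionE _ _ _ _ ip) E0 mxE.
  - by rewrite mxE.
rewrite (derive_along_addZ _ _ _ dz) derive_jet2_top /= coordK //.
by rewrite mulrN opprB.
Qed.

End obstruction.

(** * Functions with a prescribed 2-jet *)

Section local_jets.
Context {R : realType} {n : nat} {M : manifold R n}.

(** A quadratic polynomial in the coordinates of [i] centred at [p]. Its values off [dom i] are
    irrelevant, since only the germ at [p] is asserted to be smooth. *)
Lemma exists_jet (i : atlas M) (p : M) (y : R) (phi : 'cV[R]_n) (S : 'M[R]_n) :
  dom i p -> S^T = S -> exists u : M -> R^o, [/\ smooth_at p u, u p = y,
    grad i u p = phi & forall b c, partial i b (partial i c u) p = S b c].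
Proof.
move=> ip Ssym.
pose xi (a : 'I_n) (q : M) : R^o := coord i q 0 a - coord i p 0 a.
have sc a q : dom i q -> smooth_at q (fun q => coord i q 0 a : R^o).
  by move=> iq; apply: smooth_at_entry; exact: smooth_at_coord.
have sxi a q : dom i q -> smooth_at q (xi a).
  by move=> iq; apply: smooth_atB; [exact: sc|exact: smooth_at_cst].
have dxi a b q : dom i q -> partial i b (xi a) q = (b == a)%:R.
  move=> iq; rewrite /xi (partialB b (sc a q iq) (smooth_at_cst q (coord i p 0 a : R^o)) iq).
  by rewrite partial_cst subr0 partial_coord.
have xi0 a : xi a p = 0 by rewrite /xi subrr.
pose L (c : 'I_n) (q : M) : R^o := phi c 0 + \sum_b S c b * xi b q.
pose Q (c : 'I_n) (q : M) : R^o := \sum_b S c b * xi b q.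
have sS c b q : dom i q -> smooth_at q (fun q => S c b * xi b q : R^o).
  by move=> iq; apply: smooth_atM; [exact: smooth_at_cst|exact: sxi].
have sQ c q : dom i q -> smooth_at q (Q c).
  by move=> iq; apply: smooth_at_sum => b _; exact: sS.
have dQ c a q : dom i q -> partial i a (Q c) q = S c a.
  move=> iq; rewrite /Q partial_sum //; last by move=> b; exact: sS.
  rewrite (bigD1 a) //= big1 => [|b ba].
    by rewrite (partialZ a _ (sxi a q iq) iq) dxi // eqxx mulr1 addr0.
  by rewrite (partialZ a _ (sxi b q iq) iq) dxi // eq_sym (negbTE ba) mulr0.
have Q0 c : Q c p = 0 by rewrite /Q big1 // => b _; rewrite xi0 mulr0.
pose u1 (q : M) : R^o := \sum_a phi a 0 * xi a q.
pose u2 (q : M) : R^o := \sum_a xi a q * Q a q.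
(* By symmetry of [S] each derivative of the quadratic form [u2] is twice the linear form [Q]; the
   factor 1/2 compensates. *)
pose u (q : M) : R^o := y + (u1 q + 2^-1 * u2 q).
have s1 a q : dom i q -> smooth_at q (fun q => phi a 0 * xi a q : R^o).
  by move=> iq; apply: smooth_atM; [exact: smooth_at_cst|exact: sxi].
have s2 a q : dom i q -> smooth_at q (fun q => xi a q * Q a q : R^o).
  by move=> iq; apply: smooth_atM; [exact: sxi|exact: sQ].
have su1 q : dom i q -> smooth_at q u1 by move=> iq; apply: smooth_at_sum => a _; exact: s1.
have su2 q : dom i q -> smooth_at q u2 by move=> iq; apply: smooth_at_sum => a _; exact: s2.
have sh2 q : dom i q -> smooth_at q (fun q => 2^-1 * u2 q : R^o).
  by move=> iq; apply: smooth_atM; [exact: smooth_at_cst|exact: su2].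
have su12 q : dom i q -> smooth_at q (fun q => u1 q + 2^-1 * u2 q : R^o).
  by move=> iq; apply: smooth_atD; [exact: su1|exact: sh2].
have su q : dom i q -> smooth_at q u.
  by move=> iq; apply: smooth_atD; [exact: smooth_at_cst|exact: su12].
have du1 c q : dom i q -> partial i c u1 q = phi c 0.
  move=> iq; rewrite /u1 partial_sum //; last by move=> a; exact: s1.
  rewrite (bigD1 c) //= big1 => [|b bc].
    by rewrite (partialZ c _ (sxi c q iq) iq) dxi // eqxx mulr1 addr0.
  by rewrite (partialZ c _ (sxi b q iq) iq) dxi // eq_sym (negbTE bc) mulr0.
have du2 c q : dom i q -> partial i c u2 q = 2 * Q c q.
  move=> iq; rewrite /u2 partial_sum //; last by move=> a; exact: s2.
  under eq_bigr => a _ do rewrite (partialM c (sxi a q iq) (sQ a q iq) iq) dQ // dxi //.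
  rewrite big_split /= mulr_natl mulr2n; congr (_ + _).
    apply: eq_bigr => a _; rewrite mulrC; congr (_ * _).
    by rewrite -[in LHS]Ssym mxE.
  rewrite (bigD1 c) //= big1 => [|b bc]; first by rewrite eqxx mulr1 addr0.
  by rewrite eq_sym (negbTE bc) mulr0.
have du c q : dom i q -> partial i c u q = phi c 0 + Q c q.
  move=> iq; rewrite /u (partialD c (smooth_at_cst q (y : R^o)) (su12 q iq) iq).
  rewrite partial_cst add0r (partialD c (su1 q iq) (sh2 q iq) iq) du1 //.
  by rewrite (partialZ c _ (su2 q iq) iq) du2 // mulrA mulVf ?mul1r // pnatr_eq0.
exists u; split.
- exact: su.
- rewrite /u /u1 /u2 big1 => [|a _]; last by rewrite xi0 mulr0.
  by rewrite big1 ?mulr0 ?addr0 // => a _; rewrite xi0 mul0r.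
- by apply/colP => c; rewrite mxE du // Q0 addr0.
- move=> b c; rewrite (@partial_near _ _ _ i b p _ (fun q => phi c 0 + Q c q)) //; last first.
    by apply: filterS (near_dom ip) => q iq; exact: du.
  rewrite (partialD b (smooth_at_cst p (phi c 0 : R^o)) (sQ c p ip) ip).
  by rewrite partial_cst add0r dQ // -[in LHS]Ssym mxE.
Qed.

End local_jets.

(** * The equation for dh and its independence of the chart *)

Section integrability.
Context {R : realType} {n : nat} (hn : (2 <= n)%N) {M : manifold R n}.
Implicit Types (i j : atlas M) (p q : M) (f u H : M -> R^o).
Context (g : M -> 'M[R]_n) (gR : riemannian_metric g).
Context (Gamma : coefficients M) (GammaL : linear_connection Gamma).
Context (GammaT : torsion_free Gamma).
Context (A : M -> fiber_J1 R n -> 'M[R]_n).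
Context (AB : bundle_map (transition_J1 M) (transition_T2 M) A).
Context (AS : forall p v, S20 g p (A p v)).

Notation gi := (components (transition_T2 M)).
Notation Ai := (bundle_map_in_chart (transition_J1 M) (transition_T2 M) A).
Notation jet2 := (jet2 g Gamma A).
Notation jet3 := (jet3 g Gamma A).
Notation tau := (tau g Gamma A).
Notation obstruction := (obstruction g Gamma A).

(** Third partial derivatives of [u] cancel by symmetry. Keeping both the derivatives of [H] and
    those of E gives one identity for two uses: on a solution the latter vanish, for constant [H]
    the former. *)
Lemma jet3_altE i u H p a b c :
  smooth_at p u -> smooth_at p H -> dom i p -> obstruction i u H p = 0 ->
  jet3 i a b c (jet i u H p) - jet3 i b a c (jet i u H p) =
  partial i a H p * gi i g p b c - partial i b H p * gi i g p a c -
  (partial i a (fun q => obstruction i u H q b c) p -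
   partial i b (fun q => obstruction i u H q a c) p).
Proof.
move=> us Hs ip E0.
have Ea := partial_obstruction gR GammaL AB a b c us Hs ip E0.
have Eb := partial_obstruction gR GammaL AB b a c us Hs ip E0.
have S := partial_comm a b (smooth_at_partial c us ip) ip.
rewrite Ea Eb S; ring.
Qed.

Lemma tau_solution i f H p : smooth_at p f -> smooth_at p H -> dom i p ->
  (\forall q \near p, obstruction i f H q = 0) ->
  grad i H p = tau i (jet i f H p).
Proof.
move=> fs Hs ip E0.
have E0p := nbhs_singleton E0.
have dE0 a b c : partial i a (fun q => obstruction i f H q b c) p = 0.
  rewrite -[RHS](partial_cst i a p (0 : R)); apply: partial_near => //.
  by apply: filterS E0 => q ->; rewrite mxE.
have ug := components_metric_unitmx gR ip.
apply/colP => a; rewrite !mxE /= coordK //.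
under eq_bigr => b _ do under eq_bigr => c _ do
  rewrite (jet3_altE _ _ _ fs Hs ip E0p) !dE0 subrr subr0 mulrBr.
under eq_bigr => b _ do rewrite sumrB.
rewrite sumrB.
have gs b c : gi i g p b c = gi i g p c b.
  by rewrite -[in LHS](components_metric_sym gR i p) mxE.
have VG b d : \sum_c invmx (gi i g p) b c * gi i g p c d = (b == d)%:R.
  by have := congr1 (fun X : 'M[R]_n => X b d) (mulVmx ug); rewrite !mxE.
(* Here g^bc g_bc = n, while in the next contraction g^bc g_ac is a Kronecker delta and leaves a
   single d_a H. The difference is the factor n - 1 inverted in [tau], nonzero by [hn]. *)
have -> : \sum_b \sum_c invmx (gi i g p) b c * (partial i a H p * gi i g p b c) =
    n%:R * partial i a H p.
  transitivity (\sum_(b < n) partial i a H p).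
    apply: eq_bigr => b _; under eq_bigr => c _ do rewrite gs mulrCA.
    by rewrite -mulr_sumr VG eqxx mulr1.
  by rewrite sumr_const card_ord mulr_natl.
have -> : \sum_b \sum_c invmx (gi i g p) b c * (partial i b H p * gi i g p a c) =
    partial i a H p.
  transitivity (\sum_(b < n) partial i b H p * (b == a)%:R).
    apply: eq_bigr => b _; under eq_bigr => c _ do rewrite gs mulrCA.
    by rewrite -mulr_sumr VG.
  rewrite (bigD1 a) //= eqxx mulr1 big1 ?addr0 // => b ba.
  by rewrite (negbTE ba) mulr0.
rewrite -{3}[partial i a H p]mul1r -mulrBl mulrA mulVf ?mul1r //.
by rewrite subr_eq0 pnatr_eq1; case: (n) hn => [|[]].
Qed.

(** Symmetry is the condition for [jet2] to be the matrix of second derivatives of a function, as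
    [exists_jet] demands. It comes from torsion-freeness and from the symmetry of the values of
    [A]. *)
Lemma jet2_sym i z : zdom i z -> (jet2 i z)^T = jet2 i z.
Proof.
move=> iz; have ip := param_dom iz.
have Asym : (Ai i (z.1, (z.2.2, z.2.1.2)))^T = Ai i (z.1, (z.2.2, z.2.1.2)).
  rewrite /bundle_map_in_chart /transition_T2 /= !trmx_mul trmxK mulmxA.
  by rewrite (AS _ _).1.
rewrite /jet2 !linearB /= linearZ /= (components_metric_sym gR) Asym.
congr (_ - _ - _); apply/matrixP => b c; rewrite !mxE.
by apply: eq_bigr => e _; rewrite GammaT.
Qed.

Lemma tau_tensor i j p (s : fiber_V R n) : dom i p -> dom j p ->
  tau j (coord j p, transition_V M i j p s) =
  transition_T1 M i j p (tau i (coord i p, s)).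
Proof.
move=> ip jp; case: s => [[h phi] y].
have iz : zdom i (coord i p, (h, phi, y) : fiber_V R n) by exists p.
(* [E = Hess u + H g + A(u, du)] vanishes at [p], so its first partial derivatives
   transform there like a tensor. *)
have [u [us up du ddu]] := exists_jet y phi ip (jet2_sym iz).
pose H (q : M) : R^o := h.
have Hs : smooth_at p H by exact: smooth_at_cst.
have zi : jet i u H p = (coord i p, (h, phi, y)) by rewrite /jet up du.
have zj : jet j u H p = (coord j p, transition_V M i j p (h, phi, y)).
  by rewrite /jet up (grad_chain us ip jp) du.
have Ei : obstruction i u H p = 0.
  by apply/matrixP => b c; rewrite obstructionE // ddu zi subrr mxE.
have Ej : obstruction j u H p = 0.
  rewrite (@obstruction_tensor _ _ _ g _ GammaL A i j u H p us ip jp) Ei.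
  by rewrite /transition_T2 mulmx0 mul0mx.
rewrite -zi -zj.
pose J := jac i j p.
pose Ti a b c := partial i a (fun q => obstruction i u H q b c) p.
pose Tj a b c := partial j a (fun q => obstruction j u H q b c) p.
have sE m k : smooth_at p (fun q => obstruction i u H q m k : R^o).
  exact: (smooth_at_obstruction gR GammaL AB).
have sJ b m : smooth_at p (fun q => jac i j q b m : R^o) by exact: smooth_at_jac.
have T3 a b c : Tj a b c = \sum_k \sum_m J c k * (J b m * \sum_l J a l * Ti l m k).
  rewrite /Tj (@partial_near _ _ _ j a p _ (fun q => \sum_k \sum_m
      (jac i j q b m * obstruction i u H q m k) * jac i j q c k)) //; last first.
    near=> q; rewrite (@obstruction_tensor _ _ _ g _ GammaL A i j u H q); last 3 first.
    - by near: q; exact: smooth_at_near.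
    - by near: q; exact: near_dom.
    - by near: q; exact: near_dom.
    rewrite /transition_T2 mxE; apply: eq_bigr => k _.
    by rewrite mxE [in X in _ * X]mxE mulr_suml.
  have s1 k m : smooth_at p (fun q => jac i j q b m * obstruction i u H q m k : R^o).
    by apply: smooth_atM; [exact: sJ|exact: sE].
  have s2 k m : smooth_at p (fun q =>
      jac i j q b m * obstruction i u H q m k * jac i j q c k : R^o).
    by apply: smooth_atM; [exact: s1|exact: sJ].
  rewrite partial_sum //; last by move=> k; apply: smooth_at_sum => m _; exact: s2.
  apply: eq_bigr => k _; rewrite partial_sum //; apply: eq_bigr => m _.
  (* The two terms of the product rule in which a Jacobian is differentiated carry the factor E(p) =
     0. *)
  rewrite (partialM a (s1 k m) (sJ c k) jp) (partialM a (sJ b m) (sE m k) jp).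
  have z0 : (0 : 'M[R]_n) m k = 0 by rewrite mxE.
  by rewrite (partial_chain a (sE m k) ip jp) Ei z0 mulr0 !mul0r add0r addr0.
(* The entries are d_l E_mk - d_m E_lk. Fixing l presents this three-index object as n matrices, to
   which the matrix transition law applies. *)
pose X l := \matrix_(m, k) (Ti l m k - Ti m l k).
have Xj a : \matrix_(b, c) (Tj a b c - Tj b a c) =
    \sum_l J a l *: transition_T2 M i j p (X l).
  apply/matrixP => b c; rewrite mxE summxE.
  transitivity (\sum_l J a l * \sum_k (\sum_m J b m * X l m k) * J c k); last first.
    apply: eq_bigr => l _; rewrite /transition_T2 [RHS]mxE; congr (_ * _).
    by rewrite [RHS]mxE; apply: eq_bigr => k _; congr (_ * _); rewrite [RHS]mxE.
  have -> : Tj a b c = \sum_l J a l * \sum_k (\sum_m J b m * Ti l m k) * J c k.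
    rewrite T3; under [RHS]eq_bigr => l _ do rewrite mulr_sumr.
    rewrite [RHS]exchange_big; apply: eq_bigr => k _ /=.
    under [RHS]eq_bigr => l _ do rewrite mulr_suml mulr_sumr.
    rewrite [RHS]exchange_big; apply: eq_bigr => m _ /=.
    by rewrite !mulr_sumr; apply: eq_bigr => l _; ring.
  have -> : Tj b a c = \sum_l J a l * \sum_k (\sum_m J b m * Ti m l k) * J c k.
    rewrite T3; under [RHS]eq_bigr => l _ do rewrite mulr_sumr.
    rewrite [RHS]exchange_big; apply: eq_bigr => k _ /=.
    by apply: eq_bigr => m _; ring.
  rewrite -sumrB; apply: eq_bigr => l _; rewrite -mulrBr -sumrB; congr (_ * _).
  apply: eq_bigr => k _; rewrite -mulrBl -sumrB; congr (_ * _).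
  by apply: eq_bigr => m _; rewrite [X in _ = _ * X]mxE mulrBr.
(* Written as a trace, the contraction in [tau] falls under [trace_transition_T2]; the transpose
   disappears because the metric is symmetric. *)
have contrE (G S : 'M[R]_n) : \sum_b \sum_c G b c * S b c = \tr (G^T *m S).
  rewrite exchange_big; apply: eq_bigr => c _ /=.
  by rewrite mxE; apply: eq_bigr => b _; rewrite mxE.
have trG S : \tr ((invmx (gi j g p))^T *m transition_T2 M i j p S) =
    \tr ((invmx (gi i g p))^T *m S).
  rewrite !trmx_inv !(components_metric_sym gR) (metric_tensor _ ip jp).
  by rewrite trace_transition_T2 //; exact: (components_metric_unitmx gR).
(* As [H] is constant, [jet3_altE] leaves only the derivatives of E, with a minus sign. *)
have tauE (k : atlas M) : dom k p -> obstruction k u H p = 0 -> forall a,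
    tau k (jet k u H p) a 0 = - (n%:R - 1)^-1 * \tr ((invmx (gi k g p))^T *m
      \matrix_(b, c) (partial k a (fun q => obstruction k u H q b c) p -
                      partial k b (fun q => obstruction k u H q a c) p)).
  move=> kp Ek a; rewrite mxE -contrE /= coordK // mulNr -mulrN -sumrN.
  congr (_ * _); apply: eq_bigr => b _; rewrite -sumrN; apply: eq_bigr => c _.
  by rewrite (jet3_altE _ _ _ us Hs kp Ek) !partial_cst !mul0r subrr sub0r mulrN mxE.
apply/colP => a; rewrite (tauE j jp Ej) (Xj a).
rewrite mulmx_sumr raddf_sum mulr_sumr /transition_T1 mxE.
apply: eq_bigr => l _; rewrite (tauE i ip Ei) /= -scalemxAr mxtraceZ trG.
by rewrite mulrCA.
Unshelve. all: by end_near. Qed.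

End integrability.

(** * The prolonged connection *)

Section solutions.
Context {R : realType} {n : nat} (hn : (2 <= n)%N) {M : manifold R n}.
Implicit Types (i j : atlas M) (p q : M) (f u H : M -> R^o).
Context (g : M -> 'M[R]_n) (gR : riemannian_metric g).
Context (Gamma : coefficients M) (GammaL : linear_connection Gamma).
Context (GammaT : torsion_free Gamma).
Context (A : M -> fiber_J1 R n -> 'M[R]_n).
Context (AB : bundle_map (transition_J1 M) (transition_T2 M) A).
Context (AS : forall p v, S20 g p (A p v)).
Context (D : (M -> R^o) -> M -> 'M[R]_n).
Context (DE : forall f, smooth_function f -> forall p,
  D f p = hessian0 g Gamma f p + A p (f p, exterior_d f p)).

Notation gi := (components (transition_T2 M)).
Notation Ai := (bundle_map_in_chart (transition_J1 M) (transition_T2 M) A).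
Notation tau := (tau g Gamma A).
Notation obstruction := (obstruction g Gamma A).

Definition prolongation p (s : fiber_V R n) : fiber_TV R n :=
  (- tau (chart_at p) (coord (chart_at p) p, s), A p (s.2, s.1.2), 0).

Lemma smooth_function_at f p : smooth_function f -> smooth_at p f.
Proof. by move=> fs; apply: smooth_on_at (fs (chart_at p)) (chart_at_dom p). Qed.

(** The preferred chart in [prolongation] may jump with p. [tau_tensor] turns the top slot into
    [- tau i] for the fixed chart [i], whose smoothness is [smooth_tau]; the middle slot is smooth
    because [A] is a bundle map. *)
Lemma prolongation_bundle_map :
  bundle_map (transition_V M) (transition_TV M) prolongation.
Proof.
move=> i k; have oz := @open_zdom R n M i.
have cid := @Ck_id R _ k _ oz; have c2 := Ck_snd oz cid; have c1 := Ck_fst oz cid.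
have c22 := Ck_snd oz c2; have c21 := Ck_fst oz c2; have c212 := Ck_snd oz c21.
apply: (@Ck_eq _ _ _ _ _ (fun x : 'rV[R]_n * fiber_V R n =>
  (- tau i x, Ai i (x.1, (x.2.2, x.2.1.2)), 0) : fiber_TV R n)) => //.
  move=> [x s] ix; have ip := param_dom ix.
  have cp := chart_at_dom (param i x).
  have xE : x = coord i (param i x) by rewrite paramK.
  have sE : transition_V M (chart_at (param i x)) i (param i x)
      (transition_V M i (chart_at (param i x)) (param i x) s) = s.
    rewrite /transition_V /= transition_T1_comp // transition_T1_id //.
    by rewrite -!surjective_pairing.
  have T := tau_tensor gR GammaL GammaT AB AS
    (transition_V M i (chart_at (param i x)) (param i x) s) cp ip.
  rewrite sE -xE in T; rewrite T /bundle_map_in_chart /transition_TV /=.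
  by congr (_, _, _); rewrite /transition_T1 ?mulmxN ?mulmx0.
apply: Ck_pair => //; last exact: Ck_cst.
apply: Ck_pair => //.
  apply: (@Ck_eq _ _ _ _ _ (fun x : 'rV[R]_n * fiber_V R n => (-1) *: tau i x)) => //.
    by move=> x _; rewrite scaleN1r.
  apply: (@Ck_comp_linear _ _ _ _ _ _ ( *:%R (-1) : {linear 'cV[R]_n -> 'cV[R]_n})) => //.
    exact: scaler_continuous.
  exact: (smooth_tau gR GammaL AB).
apply: (@Ck_comp _ _ _ _ _ _ _ _ _ (Ai i) (fun z : 'rV[R]_n * fiber_V R n =>
  (z.1, (z.2.2, z.2.1.2) : fiber_J1 R n)) oz _ _ (AB i k)) => //.
  by apply: open_fst; exact: cdom_open.
by apply: Ck_pair => //; exact: Ck_pair.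
Qed.

Lemma trace_gD p (S T : 'M[R]_n) : trace_g g p (S + T) = trace_g g p S + trace_g g p T.
Proof. by rewrite /trace_g mulmxDr mxtraceD. Qed.

Lemma trace_gZ p a (S : 'M[R]_n) : trace_g g p (a *: S) = a * trace_g g p S.
Proof. by rewrite /trace_g -scalemxAr mxtraceZ. Qed.

Lemma trace_g_metric p : trace_g g p (g p) = n%:R.
Proof. by rewrite /trace_g mulVmx ?mxtrace1 // (metric_unitmx gR). Qed.

Lemma obstruction_chart_at f H q : smooth_at q f ->
  obstruction (chart_at q) f H q =
  hessian Gamma f q + H q *: g q + A q (f q, exterior_d f q).
Proof.
move=> fs; have cq := chart_at_dom q.
rewrite /obstruction -hessianE // bundle_map_chartE // transition_T2_id //.
by rewrite {1}/components transition_T2_id // transition_T1_id.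
Qed.

(** Invariance of the metric trace moves the Laplacian from the preferred chart at [q] to a fixed
    chart, where its smoothness can be read off. *)
Lemma laplacian_chart i f q : smooth_at q f -> dom i q ->
  laplacian g Gamma f q = \tr (invmx (gi i g q) *m hess Gamma i f q).
Proof.
move=> fs iq; have cq := chart_at_dom q.
have uq := metric_unitmx gR q.
have gE : gi i g q = transition_T2 M (chart_at q) i q (g q) by [].
rewrite gE (hess_tensor GammaL fs cq iq) (trace_transition_T2 _ cq iq uq).
by rewrite -(hessianE Gamma fs).
Qed.

Lemma smooth_at_laplacian f p : smooth_function f ->
  smooth_at p (laplacian g Gamma f : M -> R^o).
Proof.
move=> fs; pose i := chart_at p; have ip : dom i p by exact: chart_at_dom.
have fp q := smooth_function_at q fs.
have [gs _ _] := gR.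
have sV : smooth_at p (fun q => invmx (gi i g q)).
  apply: (@smooth_on_at _ _ _ _ i) => // k.
  apply: (Ck_invmx (@cdom_open _ _ M i) _ (gs i k)).
  by move=> x ix; apply: (components_metric_unitmx gR); exact: param_dom.
have sh := smooth_at_hess GammaL (fp p) ip.
have : smooth_at p (fun q => \sum_a \sum_b invmx (gi i g q) a b *
    hess Gamma i f q b a : R^o).
  apply: smooth_at_sum => a _; apply: smooth_at_sum => b _.
  by apply: smooth_atM; exact: smooth_at_entry.
apply: smooth_at_eq; apply: filterS (near_dom ip) => q iq.
rewrite (laplacian_chart (fp q) iq) /mxtrace; apply: eq_bigr => a _.
by rewrite mxE.
Qed.

Let top f : M -> R^o := fun q => - (n%:R^-1 * laplacian g Gamma f q).

Lemma smooth_at_top f p : smooth_function f -> smooth_at p (top f).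
Proof.
move=> fs; apply: smooth_atN; apply: smooth_atM; first exact: smooth_at_cst.
exact: smooth_at_laplacian.
Qed.

Lemma splitting_smooth f : smooth_function f ->
  smooth_section (transition_V M) (splitting_L g Gamma f).
Proof.
move=> fs i; apply: smooth_at_on => p ip.
have fp q := smooth_function_at q fs.
have : smooth_at p (fun q => (top f q, grad i f q, f q) : fiber_V R n).
  apply: smooth_at_pair => //; apply: smooth_at_pair; first exact: smooth_at_top.
  exact: smooth_at_grad.
apply: smooth_at_eq; apply: filterS (near_dom ip) => q iq.
rewrite /components /transition_V /=; congr (_, _, _).
exact: esym (components_exterior_d (fp q) iq).
Qed.

Lemma prolongation_solutions :
  inverse_bijections (solutions_D D) (solutions_V g Gamma prolongation)
    (splitting_L g Gamma) (@slot0 R n M).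
Proof.
have VD S : solutions_V g Gamma prolongation S ->
    [/\ smooth_function (slot0 S), forall p, D (slot0 S) p = 0
      & splitting_L g Gamma (slot0 S) = S].
  move=> [Ss Seq].
  have fs : smooth_function (slot0 S).
    by move=> i k; exact: (Ck_snd (@cdom_open _ _ M i) (Ss i k)).
  have dS p : exterior_d (slot0 S) p = (S p).1.2.
    have := congr1 snd (Seq p); rewrite /= addr0 => /eqP.
    by rewrite subr_eq0 => /eqP.
  have phiE : (fun q => (S q).1.2) = exterior_d (slot0 S).
    by apply/funext => q; rewrite dS.
  have hE p : hessian Gamma (slot0 S) p + (S p).1.1 *: g p +
      A p (slot0 S p, exterior_d (slot0 S) p) = 0.
    by have := congr1 (fun t => t.1.2) (Seq p); rewrite /= phiE dS.
  (* Taking the trace removes [A], whose values are tracefree, and leaves Laplacian + n h = 0. *)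
  have topE p : top (slot0 S) p = (S p).1.1.
    have := congr1 (trace_g g p) (hE p); rewrite !trace_gD trace_gZ trace_g_metric.
    have [_ ->] := AS p (slot0 S p, exterior_d (slot0 S) p).
    rewrite addr0 /trace_g mulmx0 mxtrace0 -/(trace_g g p _) => /eqP.
    rewrite addr_eq0 => /eqP E; rewrite /top /laplacian E mulrN opprK mulrCA.
    rewrite mulVf ?mulr1 //.
    by rewrite pnatr_eq0; case: (n) hn.
  split => //.
    move=> p; rewrite DE // /hessian0 -[RHS](hE p) -topE /top.
    by rewrite scaleNr.
  apply/funext => p; rewrite /splitting_L dS -/(top _ p) topE.
  by rewrite -!surjective_pairing.
split.
- move=> f [fs Df]; split; first exact: splitting_smooth.
  have fp q := smooth_function_at q fs.
  have E0 q : hessian Gamma f q + top f q *: g q + A q (f q, exterior_d f q) = 0.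
    by rewrite -[RHS](Df q) DE // /hessian0 /top scaleNr.
  move=> p; have cp := chart_at_dom p.
  have T : grad (chart_at p) (top f) p = tau (chart_at p) (jet (chart_at p) f (top f) p).
    apply: (tau_solution hn gR GammaL AB (fp p) (smooth_at_top p fs) cp).
    apply: filterS (near_dom cp) => q iq.
    (* [E0] holds in the preferred chart at [q], which changes with [q]. Tensoriality carries it to
       the chart fixed at [p], as [tau_solution] requires vanishing on a whole neighbourhood in one
       chart. *)
    rewrite (@obstruction_tensor _ _ _ g _ GammaL A (chart_at q)) //.
      by rewrite obstruction_chart_at // E0 /transition_T2 mulmx0 mul0mx.
    exact: chart_at_dom.
  rewrite /nabla_tilde /prolongation /=; congr (_, _, _).
  + by rewrite -[exterior_d _ p]/(grad (chart_at p) (top f) p) T subrr.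
  + exact: E0.
  + by rewrite subrr addr0.
- by move=> S /VD[].
- by move=> f _; apply/funext.
- by move=> S /[!inE] /VD[].
Qed.

End solutions.

(** * Linear operators *)

Section linearization.
Context {R : realType} {n : nat} {M : manifold R n}.
Implicit Types (i j : atlas M) (p q : M) (f u H : M -> R^o).
Context (A : M -> fiber_J1 R n -> 'M[R]_n).
Context (AB : bundle_map (transition_J1 M) (transition_T2 M) A).

Notation Ai := (bundle_map_in_chart (transition_J1 M) (transition_T2 M) A).

Definition linearization p (v : fiber_J1 R n) : 'M[R]_n := 'D_v (A p) 0.

Let jdom i : set ('rV[R]_n * fiber_J1 R n) := [set z | cdom i z.1].

Lemma open_jdom i : open (jdom i).
Proof. by apply: open_fst; exact: cdom_open. Qed.

Lemma bundle_map_differentiable i z : jdom i z -> differentiable (Ai i) z.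
Proof. by move=> iz; exact: (C1_differentiable (@open_jdom i) (AB i 1%N) iz). Qed.

Lemma is_derive_pairr (V W : normedModType R) (x : V) (y w : W) :
  is_derive y w (fun v => (x, v)) (0, w).
Proof.
have dc : differentiable (fun _ : W => x) y by exact: differentiable_cst.
have di : differentiable (fun v : W => v) y by exact: ex_diff.
apply: DeriveDef; first by apply: diff_derivable; exact: differentiable_pair.
by rewrite derive_pair // derive_cst derive_id.
Qed.

Lemma is_derive_pairl (V W : normedModType R) (y : W) (x v : V) :
  is_derive x v (fun z => (z, y)) (v, 0).
Proof.
have dc : differentiable (fun _ : V => y) x by exact: differentiable_cst.
have di : differentiable (fun z : V => z) x by exact: ex_diff.
apply: DeriveDef; first by apply: diff_derivable; exact: differentiable_pair.
by rewrite derive_pair // derive_cst derive_id.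
Qed.

Lemma derive_split (V W : normedModType R) (F : V * W -> R^o) x y v w :
  differentiable F (x, y) ->
  'D_(v, w) F (x, y) = 'D_v (fun z => F (z, y)) x + 'D_w (fun z => F (x, z)) y.
Proof.
move=> dF; have [dl Dl] := is_derive_pairl y x v; have [dr Dr] := is_derive_pairr x y w.
have [_ Fl] := is_derive_comp dl dF; have [_ Fr] := is_derive_comp dr dF.
rewrite Dl in Fl; rewrite Dr in Fr; rewrite -[fun z => F (z, y)]/(F \o pair^~ y).
rewrite -[fun z => F (x, z)]/(F \o pair x) Fl Fr !deriveE // -linearD.
by congr ('d F _ _); congr (_, _); rewrite /= ?addr0 ?add0r.
Qed.

Lemma fiber_map_differentiable p v : differentiable (A p) v.
Proof.
have cp := chart_at_dom p; set c := chart_at p in cp *.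
have -> : A p = Ai c \o (fun w => (coord c p, w)).
  apply/funext => w /=; rewrite bundle_map_chartE // -/c transition_T2_id //.
  by rewrite transition_T1_id // -surjective_pairing.
apply: differentiable_comp; last by apply: bundle_map_differentiable; exists p.
by apply: differentiable_pair.
Qed.

Lemma linearization_linear p : linear (linearization p).
Proof.
have d0 := fiber_map_differentiable p 0.
by move=> a u v; rewrite /linearization !deriveE // linearP.
Qed.

Lemma derive_linear (V W : normedModType R) (l : {linear V -> W}) x v :
  derivable l x v /\ 'D_v l x = l v.
Proof.
have E : \forall h \near 0^', h^-1 *: ((l \o shift x) (h *: v) - l x) = l v.
  near=> h; have h0 : h != 0 by near: h; exact: nbhs_dnbhs_neq.
  by rewrite /= -linearB addrK linearZZ scalerA mulVf // scale1r.
by split; [exact: is_cvg_near_cst E|exact: lim_near_cst E].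
Unshelve. all: by end_near. Qed.

Lemma fin_dim_linear_continuous (V W : normedModType R) {fV : fin_dim V}
    (l : {linear V -> W}) : continuous l.
Proof.
have -> : (l : V -> W) = fun x => \sum_i fcoord i x *: l (fvec i).
  apply/funext => x; rewrite {1}[x]fcoordE linear_sum.
  by apply: eq_bigr => i _; rewrite linearZZ.
apply: continuous_sum => i x.
by apply: cvgZ; [exact: fcoord_continuous|exact: cvg_cst].
Qed.

Lemma derive_post_linear (V W : normedModType R) {fW : fin_dim W} (X : normedModType R)
    (l : {linear W -> V}) (f : X -> W) x v :
  derivable f x v -> 'D_v (l \o f) x = l ('D_v f x).
Proof.
by move=> df; have [_ ->] := is_derive_comp_linear (fin_dim_linear_continuous (l := l)) df.
Qed.

(** The transition maps are linear in the fibre, so they fix the zero vector and commute with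
    differentiation there. The chart expression is thus a derivative of the smooth map [Ai i] in a
    vertical direction, along the zero section. *)
Lemma linearization_chart i x v : cdom i x ->
  bundle_map_in_chart (transition_J1 M) (transition_T2 M) linearization i (x, v) =
  'D_((0, v) : 'rV[R]_n * fiber_J1 R n) (Ai i) (x, 0).
Proof.
move=> ix; have ip := param_dom ix; set p := param i x in ip.
pose c := chart_at p.
pose K (w : fiber_J1 R n) : fiber_J1 R n := transition_J1 M i c p w.
pose L (T : 'M[R]_n) : 'M[R]_n := transition_T2 M c i p T.
have linK : linear K.
  by move=> a u w; rewrite /K /transition_J1 /transition_T1 /= mulmxDr -scalemxAr.
have linL : linear L.
  move=> a S T; rewrite /L /transition_T2 mulmxDr mulmxDl -scalemxAr.
  by rewrite -scalemxAl.
pose KL : {linear fiber_J1 R n -> fiber_J1 R n} :=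
  HB.pack K (GRing.isLinear.Build _ _ _ _ _ linK).
pose LL : {linear 'M[R]_n -> 'M[R]_n} := HB.pack L (GRing.isLinear.Build _ _ _ _ _ linL).
have [dK DK] := derive_linear KL 0 v.
have [dAK DAK] := is_derive_comp dK (fiber_map_differentiable p (KL 0)).
rewrite DK linear0 in DAK.
have DL := derive_post_linear LL dAK.
have dG := is_derive_pairr x (0 : fiber_J1 R n) v.
have dAi : differentiable (Ai i) (x, 0 : fiber_J1 R n).
  exact: bundle_map_differentiable.
have [dG0 DG0] := dG.
have [_ DG] := @is_derive_comp _ _ _ _ (Ai i) (fun w => (x, w)) 0 v dG0 dAi.
rewrite DG0 in DG.
have E : Ai i \o (fun w => (x, w)) = LL \o (A p \o KL) by apply/funext.
by rewrite E DL DAK in DG; exact: DG.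
Qed.

(** The derivative of a constantly zero map. Symmetry and vanishing trace are both of this form, so
    they pass from [A] to its linearization. *)
Lemma linearization_kernel (W : normedModType R) (l : {linear 'M[R]_n -> W}) p :
  (forall v, l (A p v) = 0) -> forall v, l (linearization p v) = 0.
Proof.
move=> lA v; have dA : derivable (A p) 0 v.
  by apply: diff_derivable; exact: fiber_map_differentiable.
rewrite /linearization -(derive_post_linear l dA).
have -> : l \o A p = cst 0 by apply/funext => w /=; rewrite lA.
exact: derive_cst.
Qed.

Lemma linearization_bundle_map :
  bundle_map (transition_J1 M) (transition_T2 M) linearization.
Proof.
move=> i k; have oj := @open_jdom i.
apply: Ck_mx => // b c.
apply: (@Ck_eq _ _ _ _ _ (fun z => 'D_((0, z.2) : 'rV[R]_n * fiber_J1 R n)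
   (fun y => Ai i y b c : R^o) (z.1, 0))) => //.
  move=> [x v] ix; rewrite linearization_chart // derive_mx ?mxE //.
  by apply: diff_derivable; exact: bundle_map_differentiable.
have cid := @Ck_id R _ k _ oj.
apply: (@Ck_derive_along _ _ _ _ _ _ (jdom i) (fun y => Ai i y b c : R^o)
  (fun z => (z.1, 0)) (fun z => (0, z.2))) => //.
- exact: Ck_entry (AB i k.+1).
- by apply: Ck_pair => //; [exact: Ck_fst|exact: Ck_cst].
- by apply: Ck_pair => //; [exact: Ck_cst|exact: Ck_snd].
Qed.

Lemma linearization_S20 (g : M -> 'M[R]_n) :
  (forall p v, S20 g p (A p v)) -> forall p v, S20 g p (linearization p v).
Proof.
move=> AS p v.
pose L1 (T : 'M[R]_n) : 'M[R]_n := T^T - T.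
pose L2 (T : 'M[R]_n) : R^o := trace_g g p T.
have lin1 : linear L1.
  by move=> a S T; rewrite /L1 linearP /= scalerBr opprD addrACA.
have lin2 : linear L2 by move=> a S T; rewrite /L2 trace_gD trace_gZ.
pose LL1 : {linear 'M[R]_n -> 'M[R]_n} := HB.pack L1 (GRing.isLinear.Build _ _ _ _ _ lin1).
pose LL2 : {linear 'M[R]_n -> R^o} := HB.pack L2 (GRing.isLinear.Build _ _ _ _ _ lin2).
split.
  apply/eqP; rewrite -subr_eq0; apply/eqP.
  apply: (linearization_kernel (l := LL1)) => w.
  by rewrite /= /L1 (AS p w).1 subrr.
by apply: (linearization_kernel (l := LL2)) => w; exact: (AS p w).2.
Qed.

(** The difference quotient at 0 along [v] is constant, so agreement at [v] depends only on the
    behaviour of [A p] on the line through [v]. *)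
Lemma linearization_homogeneous p v :
  (forall t : R, A p (t *: v) = t *: A p v) -> linearization p v = A p v.
Proof.
move=> Ah; rewrite /linearization /derive; apply: lim_near_cst => //=; near=> t.
have t0 : t != 0 by near: t; exact: nbhs_dnbhs_neq.
have A0 : A p 0 = 0 by rewrite -(scale0r v) Ah scale0r.
by rewrite addr0 A0 subr0 Ah scalerA mulVf // scale1r.
Unshelve. all: by end_near. Qed.

End linearization.

(** * Homogeneity on jets of functions and linearity of the prolongation *)

Section linear_operators.
Context {R : realType} {n : nat} {M : manifold R n}.
Implicit Types (i j : atlas M) (p q : M) (f u H : M -> R^o).
Context (g : M -> 'M[R]_n) (gR : riemannian_metric g).
Context (Gamma : coefficients M).

Lemma partialZ2 i a b p (c : R) f : smooth_at p f -> dom i p ->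
  partial i a (partial i b (fun q => c * f q)) p = c * partial i a (partial i b f) p.
Proof.
move=> fs ip; rewrite -(partialZ a c (smooth_at_partial b fs ip) ip).
apply: partial_near => //; near=> q; rewrite partialZ //; near: q.
  exact: smooth_at_near.
exact: near_dom.
Unshelve. all: by end_near. Qed.

Lemma hessianZ p (c : R) f : smooth_at p f ->
  hessian Gamma (fun q => c * f q) p = c *: hessian Gamma f p.
Proof.
move=> fs; have cp := chart_at_dom p.
have cfs : smooth_at p (fun q => c * f q : R^o).
  by apply: smooth_atM => //; exact: smooth_at_cst.
rewrite !hessianE //; apply/matrixP => a b; rewrite !mxE partialZ2 // mulrBr.
congr (_ - _); rewrite mulr_sumr; apply: eq_bigr => e _.
by rewrite (partialZ e c fs cp) mulrCA.
Qed.

Lemma exterior_dZ p (c : R) f : smooth_at p f ->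
  exterior_d (fun q => c * f q) p = c *: exterior_d f p.
Proof.
move=> fs; apply/colP => a; rewrite !mxE partialZ //; exact: chart_at_dom.
Qed.

Lemma hessian0Z p (c : R) f : smooth_at p f ->
  hessian0 g Gamma (fun q => c * f q) p = c *: hessian0 g Gamma f p.
Proof.
move=> fs; rewrite /hessian0 /laplacian hessianZ // trace_gZ mulrCA.
by rewrite scalerBr scalerA.
Qed.

(** Compare D(c f) = c D(f) with the homogeneity of the tracefree Hessian: what remains is [A] on
    the multiples of the jet of [f], precisely the line that the linearization tests. *)
Lemma linear_operator_homogeneous (D : (M -> R^o) -> M -> 'M[R]_n) A :
  linear_operator D ->
  (forall f, smooth_function f -> forall p,
    D f p = hessian0 g Gamma f p + A p (f p, exterior_d f p)) ->
  forall f p (c : R), smooth_function f ->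
    A p (c *: ((f p, exterior_d f p) : fiber_J1 R n)) = c *: A p (f p, exterior_d f p).
Proof.
move=> Dlin DE f p c fs.
have s0 : smooth_function (fun _ : M => 0 : R^o).
  move=> i k.
  apply: (@Ck_eq _ _ _ _ _ (cst (0 : R^o))); [exact: cdom_open| |exact: Ck_cst].
  by [].
have D0 : D (fun=> 0) p = 0.
  have := Dlin 1 _ _ s0 s0 p; rewrite scale1r mul1r addr0 => /eqP.
  by rewrite -subr_eq0 opprD addrA subrr sub0r oppr_eq0 => /eqP.
have fp := smooth_function_at p fs.
have cfs : smooth_function (fun q => c * f q : R^o).
  move=> i k; have oc := @cdom_open _ _ M i.
  exact: (CkM oc (Ck_cst k (cdom i) (c : R^o)) (fs i k)).
have E : D (fun q => c * f q) p = c *: D f p.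
  have := Dlin c _ _ fs s0 p; rewrite D0 addr0 => <-; congr (D _ p).
  by apply/funext => q; rewrite addr0.
have := DE _ cfs p; rewrite E DE // hessian0Z // exterior_dZ // scalerDr.
by move=> /addrI ->.
Qed.

Context (A : M -> fiber_J1 R n -> 'M[R]_n).
Context (GammaL : linear_connection Gamma).
Context (AB : bundle_map (transition_J1 M) (transition_T2 M) A).
Context (Alin : forall p, linear (A p)).

Notation Ai := (bundle_map_in_chart (transition_J1 M) (transition_T2 M) A).

Lemma bundle_map_chart_linear i x : linear (fun v => Ai i (x, v)).
Proof.
move=> a u v; rewrite /bundle_map_in_chart /=; set p := param i x.
have -> : transition_J1 M i (chart_at p) p (a *: u + v) =
    a *: transition_J1 M i (chart_at p) p u + transition_J1 M i (chart_at p) p v.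
  by rewrite /transition_J1 /transition_T1 /= mulmxDr -scalemxAr.
by rewrite Alin /transition_T2 mulmxDr mulmxDl -scalemxAr -scalemxAl.
Qed.

Lemma jet2_linear i x (a : R) s s' : jet2 g Gamma A i (x, a *: s + s') =
  a *: jet2 g Gamma A i (x, s) + jet2 g Gamma A i (x, s').
Proof.
rewrite /jet2 /=.
have := bundle_map_chart_linear i x a (s.2, s.1.2) (s'.2, s'.1.2).
rewrite /= => ->.
move: (Ai i _) (Ai i _) (components _ _ _ _) => B B' G.
apply/matrixP => b c; rewrite !mxE.
have -> : \sum_e Gamma i (param i x) e b c * (a *: s.1.2 + s'.1.2) e 0 =
    a * (\sum_e Gamma i (param i x) e b c * s.1.2 e 0) +
    \sum_e Gamma i (param i x) e b c * s'.1.2 e 0.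
  rewrite mulr_sumr -big_split; apply: eq_bigr => e _ /=.
  by rewrite !mxE; ring.
by rewrite -[a *: s.1.1]/(a * s.1.1); ring.
Qed.

(** Both the jet at which [jet2] is differentiated and the direction depend on [s], so a quadratic
    term might be expected. Splitting the direction into base and fibre parts excludes it: the base
    part differentiates a function linear in [s], and on the fibre part a linear function is its own
    derivative, giving F(x, w(s)) with [w] linear. *)
Lemma jet3_linear i a b c x (t : R) s s' : cdom i x ->
  jet3 g Gamma A i a b c (x, t *: s + s') =
  t * jet3 g Gamma A i a b c (x, s) + jet3 g Gamma A i a b c (x, s').
Proof.
move=> ix; pose F z : R^o := jet2 g Gamma A i z b c.
have FL y (k : R) r r' : F (y, k *: r + r') = k * F (y, r) + F (y, r').
  by rewrite /F jet2_linear mxE [X in X + _]mxE.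
pose w (s : fiber_V R n) : fiber_V R n :=
  (0, \col_d jet2 g Gamma A i (x, s) a d, s.1.2 a 0).
have wL : w (t *: s + s') = t *: w s + w s'.
  rewrite /w; congr (_, _, _) => /=.
  - by rewrite scaler0 addr0.
  - apply/colP => d; rewrite mxE jet2_linear [RHS]mxE [X in _ = X + _]mxE.
    by rewrite [X in _ = _ * X + _]mxE [X in _ = _ + X]mxE mxE [X in X + _ = _]mxE.
  - by rewrite !mxE.
have linF y : linear (fun r => F (y, r)) by move=> k r r'; exact: FL.
have dF r : differentiable F (x, r) by exact: (jet2_differentiable gR GammaL AB).
pose G r y : R^o := F (y, r).
have dG r : differentiable (G r) x.
  by apply: (@differentiable_comp _ _ _ _ (fun y => (y, r)) F).
have E r : jet3 g Gamma A i a b c (x, r) = 'D_(delta_mx 0 a) (G r) x + F (x, w r).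
  apply: (etrans (derive_split (delta_mx 0 a) (w r) (dF r))); congr (_ + _).
  pose L : {linear fiber_V R n -> R^o} :=
    HB.pack (fun v => F (x, v)) (GRing.isLinear.Build _ _ _ _ _ (linF x)).
  exact: (derive_linear L r (w r)).2.
rewrite !E wL FL mulrDr addrACA; congr (_ + _).
have -> : G (t *: s + s') = (t \*: G s) + G s'.
  by apply/funext => y; rewrite /G FL.
have dGa r : derivable (G r) x (delta_mx 0 a) by exact: diff_derivable.
rewrite (deriveD (@derivableZ _ _ _ _ t _ _ (dGa s)) (dGa s')).
by rewrite (@deriveZ _ _ _ _ t _ _ (dGa s)).
Qed.

Lemma tau_linear i x (t : R) s s' : cdom i x ->
  tau g Gamma A i (x, t *: s + s') =
  t *: tau g Gamma A i (x, s) + tau g Gamma A i (x, s').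
Proof.
move=> ix; apply/colP => d.
pose S r := \sum_b \sum_c invmx (components (transition_T2 M) i g (param i x)) b c *
  (jet3 g Gamma A i d b c (x, r) - jet3 g Gamma A i b d c (x, r)).
have tauE r : tau g Gamma A i (x, r) d 0 = (n%:R - 1)^-1 * S r by rewrite [LHS]mxE.
have entryE (B C : 'cV[R]_n) : (t *: B + C) d 0 = t * B d 0 + C d 0 by rewrite !mxE.
have SL : S (t *: s + s') = t * S s + S s'.
  rewrite mulr_sumr -big_split; apply: eq_bigr => b _ /=.
  rewrite mulr_sumr -big_split; apply: eq_bigr => c _ /=.
  rewrite (jet3_linear d b c t s s' ix) (jet3_linear b d c t s s' ix).
  move: (jet3 _ _ _ _ _ _ _ _) (jet3 _ _ _ _ _ _ _ _) => u v.
  move: (jet3 _ _ _ _ _ _ _ _) (jet3 _ _ _ _ _ _ _ _) => u' v'.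
  by rewrite mulrCA -mulrDr opprD addrACA -mulrBr.
apply: (etrans (tauE _)); rewrite SL mulrDr mulrCA.
apply: esym; apply: (etrans (entryE _ _)).
exact: (congr2 (fun u v : R => t * u + v) (tauE s) (tauE s')).
Qed.

Lemma prolongation_linear p : linear (prolongation g Gamma A p).
Proof.
have cp := chart_at_dom p; have ix : cdom (chart_at p) (coord (chart_at p) p) by exists p.
move=> a s s'; rewrite /prolongation; congr (_, _, _).
- by rewrite /= (tau_linear a s s' ix) opprD scalerN.
- exact: (Alin p a (s.2, s.1.2) (s'.2, s'.1.2)).
- by rewrite /= scaler0 addr0.
Qed.

End linear_operators.

Theorem theorem2p4 (R : realType) (n : nat) (hn : (2 <= n)%N)
  (M : manifold R n) (g : M -> 'M[R]_n) (hg : riemannian_metric g)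
  (Gamma : coefficients M) (hGamma : levi_civita g Gamma)
  (D : (M -> R^o) -> M -> 'M[R]_n)
  (hDS : forall f, smooth_function f -> S20_section g (D f))
  (hD : quasilinear_tracefree_hessian_symbol g Gamma D) :
  (exists C : M -> fiber_V R n -> fiber_TV R n,
     bundle_map (transition_V M) (transition_TV M) C /\
     inverse_bijections (solutions_D D) (solutions_V g Gamma C)
       (splitting_L g Gamma) (@slot0 R n M)) /\
  (linear_operator D ->
   exists C : M -> fiber_V R n -> fiber_TV R n,
     vector_bundle_map (transition_V M) (transition_TV M) C /\
     inverse_bijections (solutions_D D) (solutions_V g Gamma C)
       (splitting_L g Gamma) (@slot0 R n M)).
Proof.
have [GammaL GammaT _] := hGamma.
have [D1 [A [AB AS D1E]] DE] := hD.
have DA f : smooth_function f -> forall p,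
    D f p = hessian0 g Gamma f p + A p (f p, exterior_d f p).
  by move=> fs p; rewrite DE // D1E.
split=> [|Dlin].
  exists (prolongation g Gamma A); split.
    exact: (prolongation_bundle_map hg GammaL GammaT AB AS).
  exact: (prolongation_solutions hn hg GammaL AB AS DA).
have LB := linearization_bundle_map AB.
have LS := linearization_S20 AB AS.
have DL f : smooth_function f -> forall p,
    D f p = hessian0 g Gamma f p + linearization A p (f p, exterior_d f p).
  move=> fs p; rewrite DA // linearization_homogeneous // => t.
  exact: (linear_operator_homogeneous Dlin DA).
exists (prolongation g Gamma (linearization A)); split; first split.
- exact: (prolongation_bundle_map hg GammaL GammaT LB LS).
- by move=> p; apply: (prolongation_linear hg GammaL LB) => q; exact: linearization_linear.
- exact: (prolongation_solutions hn hg GammaL LB LS DL).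
Qed.
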